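(* Let $n\ge 1$ be an integer. (1) Let $A\subset\mathbb{R}^n$ be Lebesgue measurable with positive Lebesgue measure. Then there is a compact set $E\subset\mathbb{R}^n$ of upper Minkowski dimension zero such that $A+E$ has non-empty interior. (2) Let $s\ge 0$ and let $A\subset\mathbb{R}^n$ be a non-empty Borel set of Hausdorff dimension greater than $s$. Then there is a compact set $E\subset\mathbb{R}^n$ of upper Minkowski dimension $n-s$ such that $A+E$ has non-empty interior.
   Context: $A+E=\{a+e: a\in A,\ e\in E\}$ is the Minkowski sum. Upper Minkowski dimension is the upper box-counting dimension. *)

(* Defs.v *)
From HB Require Import structures.
From mathcomp Require Import all_boot all_order all_algebra.
From mathcomp Require Import all_classical all_reals all_analysis.

Set Implicit Arguments.
Unset Strict Implicit.
Unset Printing Implicit Defensive.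

Import Order.TTheory GRing.Theory Num.Theory.
Import numFieldTopology.Exports numFieldNormedType.Exports.

Local Open Scope classical_set_scope.
Local Open Scope ring_scope.

(* R^n is 'rV[R]_n with its library topology, the product topology. The library
   norm on matrices is the sup norm, hence the separate Euclidean norm used for
   diameters. *)

Section Boxes.
Context {R : realType} {n : nat}.
Implicit Types a b : 'rV[R]_n.

Definition box a b : set 'rV[R]_n :=
  [set x | forall i, a 0 i <= x 0 i <= b 0 i].

(* The truncation at 0 gives volume 0 to the empty box, for n > 0. *)
Definition box_volume a b : R := \prod_(i < n) Num.max 0 (b 0 i - a 0 i).

End Boxes.

Section LebesgueMeasure.
Context {R : realType} {n : nat}.
Implicit Type A : set 'rV[R]_n.
Local Open Scope ereal_scope.

Definition lebesgue_outer A : \bar R :=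
  ereal_inf [set \sum_(0 <= k <oo) (box_volume (ab k).1 (ab k).2)%:E
            | ab in [set ab : nat -> 'rV[R]_n * 'rV[R]_n |
                     A `<=` \bigcup_k box (ab k).1 (ab k).2]].

(* Lebesgue measure is the restriction of lebesgue_outer to these sets. *)
Definition lebesgue_measurable A : Prop := lebesgue_outer.-caratheodory A.

End LebesgueMeasure.

Definition borel_set {T : topologicalType} (A : set T) : Prop :=
  <<s [set U : set T | open U] >> A.

Section Dimensions.
Context {R : realType} {n : nat}.
Implicit Types (A E U : set 'rV[R]_n) (s d : R).

Definition enorm (x : 'rV[R]_n) : R := Num.sqrt (\sum_(i < n) x 0 i ^+ 2).

Local Open Scope ereal_scope.

(* The empty set has diameter 0. *)
Definition diam U : \bar R :=
  maxe 0 (ereal_sup [set (enorm (x - y))%:E | x in U & y in U]).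

(* diam(U)^s with the conventions 0^0 = 1 for U nonempty and diam(set0)^s = 0
   for every s, so that the case s = 0 yields the counting measure. *)
Definition diam_pow s U : \bar R :=
  if U == set0 then 0 else diam U `^ s.

Definition hausdorff_content s d A : \bar R :=
  ereal_inf [set \sum_(0 <= k <oo) diam_pow s (U k)
            | U in [set U : nat -> set 'rV[R]_n |
                    A `<=` \bigcup_k U k /\ forall k, diam (U k) <= d%:E]].

Definition hausdorff_measure s A : \bar R :=
  ereal_sup [set hausdorff_content s d A | d in [set d : R | (0 < d)%R]].

Definition hausdorff_dim A : \bar R :=
  ereal_inf [set s%:E | s in
              [set s : R | (0 <= s)%R /\ hausdorff_measure s A = 0]].

(* The least number of sets of diameter at most d that cover E (+oo if no
   finite cover exists). *)
Definition covering_number d E : \bar R :=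
  ereal_inf [set k%:R%:E | k in
              [set k : nat | exists U : 'I_k -> set 'rV[R]_n,
                E `<=` \bigcup_i U i /\ forall i, diam (U i) <= d%:E]].

(* limsup of log N(d) / log (1/d) as d tends to 0 from the right. *)
Definition upper_minkowski_dim E : \bar R :=
  limf_esup (fun d : R => lne (covering_number d E) * ((- ln d)^-1)%:E) 0^'+.

Definition minkowski_sum A E : set 'rV[R]_n :=
  [set (a + e)%R | a in A & e in E].

End Dimensions.

(* Main.v *)
Require Import Defs.
From HB Require Import structures.
From mathcomp Require Import all_boot all_order all_algebra.
From mathcomp Require Import all_classical all_reals all_analysis.
From mathcomp Require Import zify ring lra.

(** Both parts follow from one construction.  Give each dyadic cube of level [m]
    (side [2 ^ -m]) a mass that is at most [2 ^ (- s m)], at most the sum of the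
    masses of its subcubes of any finer level, and positive for some unit cube
    [Q].  Then ([hitting_set]) there is a compact [E] of upper Minkowski dimension
    [n - s] such that every [x] in [Q] has an [e] in [E] for which [x - e] is a
    limit of cubes of positive mass.

    To find [e], translate [x] step by step into cubes of large mass, going from
    level [j ^ 3] to level [(j + 1) ^ 3].  Suppose that the current translate of
    [x] lies in a cube of mass [M].  By a pigeonhole principle
    ([mass_pigeonhole]) there is a [d] such that at least [2 ^ d] subcubes of the
    next level have mass at least [M / 2 ^ d], up to a factor polynomial in [j].
    If cubes are subdivided into [2 ^ (n T)] subcubes, about [2 ^ (n T - d)]
    well-chosen small translations suffice, whatever the cube and whatever the
    position in it, to move into one of these heavy subcubes ([exists_hitting]):
    only the logarithm of the number of possible situations matters, and this is
    again polynomial in [j].  After drops adding up to [q] at level [m], the mass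
    is still at least about [2 ^ - q], so the bound on masses forces [q >= s m]
    up to lower-order terms, while the number of translations used is about
    [2 ^ (n m - q)].  Hence the translations number at most [2 ^ ((n - s) m)] up
    to subexponential factors ([size_admissible]), and their limits form a set of
    dimension at most [n - s].  Adding points of suitable grids ([padded]) makes
    the dimension exactly [n - s].

    The masses are dyadic net contents, the analogue of Hausdorff contents with
    dyadic cubes as covering sets.  For a closed [K] whose content is positive,
    the contents of the intersections of [K] with cubes give [K + E] an interior
    ([net_content_sumset]).  A measurable set of positive measure contains a
    closed set of positive measure, hence of positive content for the exponent
    [n].  A set of Hausdorff dimension above [s] has positive content for the
    exponent [s]; if it is Borel, it is a Suslin set, and since net contents are
    continuous along increasing sequences of sets ([net_content_continuous]),
    Choquet's capacitability argument ([suslin_capacity]) gives decreasing sets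
    of content bounded below whose closures have their intersection inside the
    given set.  The limits of the contents of their traces on cubes are then the
    masses. *)

Set Implicit Arguments.
Unset Strict Implicit.
Unset Printing Implicit Defensive.

Import Order.TTheory GRing.Theory Num.Theory.
Import numFieldTopology.Exports numFieldNormedType.Exports.

(** * Hitting sets and a pigeonhole principle for masses *)

Section Hitting.
Local Open Scope nat_scope.

(** One factor [1 - 1/x] repeated [x] times at least halves: this is what makes
    the number of greedy steps logarithmic in the number of sets to be hit. *)
Lemma bernoulli_half (x : nat) : 0 < x -> 2 * x.-1 ^ x <= x ^ x.
Proof.
case: x => // y _ /=.
have H k : y ^ k.+1 + k.+1 * y ^ k <= y.+1 ^ k.+1.
  elim: k => [|k IH]; first by rewrite !expn0 !expn1; lia.
  rewrite (expnS y.+1) (leq_trans _ (leq_mul (leqnn _) IH)) //.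
  rewrite !(expnS y); nia.
apply: leq_trans (H y); rewrite (expnS y); nia.
Qed.

(** If every set has at least [r] points, then on average a point of [U] lies in a
    fraction [r / #|U|] of the sets not yet hit, so some point lies in that many;
    adding it multiplies the number of unhit sets by at most [1 - r / #|U|]. *)
Lemma greedy_hitting (U W : finType) (S : W -> {set U}) (A : {set W}) (r k : nat) :
  (forall w, w \in A -> r <= #|S w|) ->
  exists2 F : seq U, size F <= k &
    #|[set w in A | ~~ has [in S w] F]| * #|U| ^ k <= #|A| * (#|U| - r) ^ k.
Proof.
move=> rS; elim: k => [|k [F sF IH]].
  exists [::] => //; rewrite !expn0 !muln1; apply: subset_leq_card.
  by apply/fintype.subsetP => w; rewrite inE => /andP[].
set B := [set w in A | _] in IH.
have [B0|[w0 w0B]] := set_0Vmem B.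
  exists F; first exact: leqW.
  by rewrite -/B B0 cards0.
have [r0|r_gt0] := posnP r.
  exists F; first exact: leqW.
  by move: IH; rewrite -/B r0 subn0 !expnSr !mulnA => IH; apply: leq_mul.
have SB w : w \in B -> r <= #|S w| by rewrite inE => /andP[/rS].
have /card_gt0P[u0 _] := leq_trans r_gt0 (SB _ w0B).
pose g u := #|[set w in B | u \in S w]|.
have [u umax] := bigop.eq_bigmax g (introT card_gt0P (ex_intro _ u0 isT)).
(* Double counting of the pairs of a point and an unhit set containing it. *)
have cnt : #|B| * r <= #|U| * g u.
  have : #|B| * r <= \sum_(u : U) g u.
    have -> : \sum_(u : U) g u = \sum_(w in B) #|S w|.
      under eq_bigr => v _ do rewrite /g -sum1_card big_mkcond.
      rewrite exchange_big [RHS]big_mkcond /=; apply: eq_bigr => w _.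
      case: ifPn => wB.
        by rewrite -sum1_card [RHS]big_mkcond; apply: eq_bigr => v _; rewrite inE wB.
      by rewrite big1 // => v _; rewrite inE (negbTE wB).
    rewrite -sum_nat_const; apply: leq_sum => w; exact: SB.
  move=> /leq_trans; apply; rewrite -sum_nat_const; apply: leq_sum => v _.
  by rewrite -umax; apply: leq_bigmax.
exists (u :: F); first by rewrite /= ltnS.
set B' := [set w in A | _].
have B'E : #|B'| = #|B| - g u.
  rewrite /g -cardsDS; last by apply/fintype.subsetP => w; rewrite inE => /andP[].
  apply: eq_card => w; rewrite !inE /= negb_or.
  by case: (w \in A); case: (u \in S w); case: (has _ F).
have guB : g u <= #|B|.
  by apply: subset_leq_card; apply/fintype.subsetP => w; rewrite inE => /andP[].
have rU : r <= #|U| := leq_trans (SB _ w0B) (max_card _).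
rewrite B'E !expnS mulnA.
have : (#|B| - g u) * #|U| <= #|B| * (#|U| - r).
  rewrite mulnBl mulnBr leq_sub2l // mulnC; lia.
move=> /leq_mul => /(_ _ _ (leqnn (#|U| ^ k))) /leq_trans; apply.
by rewrite mulnAC [X in _ <= X]mulnCA [X in _ <= X]mulnC leq_mul2r IH orbT.
Qed.

(** Take so many greedy steps that less than one set remains unhit.  The number
    of sets enters only through its logarithm [a]. *)
Lemma exists_hitting (U W : finType) (S : W -> {set U}) (a b d : nat) :
  #|U| = 2 ^ (b + d) -> #|W| <= 2 ^ a ->
  exists2 F : seq U, size F <= 2 ^ b * a.+1 &
    forall w, 2 ^ d <= #|S w| -> has [in S w] F.
Proof.
move=> cU cW; pose A := [set w | 2 ^ d <= #|S w|].
have [|F sF HF] := @greedy_hitting U W S A (2 ^ d) (2 ^ b * a.+1).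
  by move=> w; rewrite inE.
exists F => // w wS; apply: contraLR HF => wF; rewrite -ltnNge.
have : 0 < #|[set w in A | ~~ has [in S w] F]|.
  by apply/card_gt0P; exists w; rewrite !inE wS wF.
move=> B0; apply: leq_trans (leq_pmull _ B0).
have -> : #|U| - 2 ^ d = (2 ^ b).-1 * 2 ^ d.
  by rewrite cU expnD -subn1 mulnBl mul1n.
rewrite cU [in X in _ < X]expnD !expnMn mulnA ltn_pmul2r ?expn_gt0 //.
rewrite !expnM.
have H : (2 * (2 ^ b).-1 ^ 2 ^ b) ^ a.+1 <= ((2 ^ b) ^ 2 ^ b) ^ a.+1.
  by rewrite leq_exp2r // bernoulli_half // expn_gt0.
set x := (_.-1 ^ _) ^ _; have [->|x0] := posnP x; first by rewrite muln0 !expn_gt0.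
apply: leq_trans H; rewrite expnMn -/x ltn_pmul2r //.
apply: leq_ltn_trans (_ : 2 ^ a < _); last by rewrite ltn_exp2l.
by apply: leq_trans (max_card _) cW.
Qed.

End Hitting.

Local Open Scope ring_scope.

(** A mass at most [A] is bounded by the geometric series of the thresholds
    [A / 2 ^+ d] that it exceeds. *)
Lemma layer_cake (R : realFieldType) (A x : R) (N : nat) : 0 <= A -> x <= A ->
  x <= A / 2 ^+ N +
       \sum_(1 <= d < N.+1) (if A / 2 ^+ d <= x then A / 2 ^+ d else 0).
Proof.
move=> A0 xA.
elim: N => [|N IH]; first by rewrite expr0 divr1 big_nil addr0.
rewrite big_nat_recr //=; case: ifPn => [_|].
  apply: le_trans IH _; rewrite exprS.
  have : A / (2 * 2 ^+ N) = A / 2 ^+ N / 2 by field; rewrite expf_neq0.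
  lra.
rewrite -ltNge => xl; rewrite addr0 (le_trans (ltW xl)) // lerDl.
apply: sumr_ge0 => d _; case: ifP => // _; exact: divr_ge0.
Qed.

(** Otherwise each threshold [A / 2 ^+ d], with [A] the [N.+2]-nd part of [a], is
    exceeded by fewer than [2 ^ d] points; the layer-cake bound then makes each of
    the [N.+1] scales contribute at most [A], which does not add up to [a]. *)
Lemma mass_pigeonhole (R : realFieldType) (D : finType) (N : nat) (mu : D -> R) (a : R) :
  (#|D| <= 2 ^ N)%N -> 0 < a -> a <= \sum_v mu v ->
  exists2 d : nat, (d <= N)%N &
    (2 ^ d <= #|[set v | (a / (N.+2%:R * 2 ^+ d) <= mu v)%R]|)%N.
Proof.
move=> cD a0 aS.
pose A := a / N.+2%:R; have A0 : 0 < A by rewrite divr_gt0.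
have AE d : a / (N.+2%:R * 2 ^+ d) = A / 2 ^+ d by rewrite invfM mulrA.
have [/existsP[d Hd]|] := boolP [exists d : 'I_N.+1,
    (2 ^ d <= #|[set v | (a / (N.+2%:R * 2 ^+ d) <= mu v)%R]|)%N].
  by exists d; rewrite // -ltnS.
rewrite negb_exists => /forallP H.
have {}H d : (d <= N)%N -> (#|[set v | (A / 2 ^+ d <= mu v)%R]| < 2 ^ d)%N.
  by rewrite -ltnS => dN; have := H (Ordinal dN); rewrite -ltnNge /= AE.
exfalso.
have muA v : mu v <= A.
  have := H 0%N isT; rewrite expn0 ltnS leqn0 cards_eq0 => /eqP/setP/(_ v).
  by rewrite !inE expr0 divr1 => /negbT; rewrite -ltNge => /ltW.
have : \sum_v mu v <= \sum_v (A / 2 ^+ N +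
       \sum_(1 <= d < N.+1) (if A / 2 ^+ d <= mu v then A / 2 ^+ d else 0)).
  by apply: ler_sum => v _; apply: layer_cake; rewrite ?(ltW A0).
rewrite big_split /= sumr_const exchange_big /=.
have B1 : A / 2 ^+ N *+ #|D| <= A.
  rewrite -mulr_natr -mulrA ler_piMr ?(ltW A0) // mulrC ler_pdivrMr ?exprn_gt0 //.
  by rewrite mul1r -natrX ler_nat.
have B2 : \sum_(1 <= d < N.+1) \sum_(v : D)
     (if A / 2 ^+ d <= mu v then A / 2 ^+ d else 0) <= A *+ N.
  rewrite -[X in A *+ X](card_ord N) -sumr_const big_add1 big_mkord.
  apply: ler_sum => d _; rewrite -big_mkcond /= sumr_const.
  rewrite -[leLHS]mulr_natr -mulrA ler_piMr ?(ltW A0) // mulrC.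
  rewrite ler_pdivrMr ?exprn_gt0 // mul1r -[leRHS]natrX ler_nat ltnW //.
  by have := H d.+1 (ltn_ord d); rewrite cardsE.
move=> B3; have : a <= A *+ N.+1.
  by rewrite mulrS; apply: le_trans aS (le_trans B3 (lerD B1 B2)).
rewrite leNgt => /negP; apply.
rewrite -mulr_natr /A mulrAC ltr_pdivrMr // ltr_pM2l // ltr_nat //.
Qed.

Local Open Scope classical_set_scope.
Local Open Scope ring_scope.

(** * Sums over sets of indices, and dyadic cubes *)

Section EsumExtra.
Context {R : realType} {T : choiceType}.
Local Open Scope ereal_scope.
Implicit Types (f : T -> \bar R) (C D : set T).

Lemma le_esum_subset f C D : C `<=` D -> \esum_(i in C) f i <= \esum_(i in D) f i.
Proof.
move=> CD; apply: ub_ereal_sup => _ [X [finX XC] <-].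
by apply: ereal_sup_ubound; exists X => //; split => // x /XC/CD.
Qed.

Lemma esum_bigcup_le f (C : nat -> set T) : (forall x, 0 <= f x) ->
  \esum_(i in \bigcup_k C k) f i <= \sum_(0 <= k <oo) \esum_(i in C k) f i.
Proof.
move=> f0; rewrite seqDU_bigcup_eq nneseries_sum_bigcup //.
apply: lee_nneseries => [k _ _|k _]; first exact: esum_ge0.
by apply: le_esum_subset; exact: subset_seqDU.
Qed.

Lemma esum_setUI f C D : (forall x, 0 <= f x) ->
  \esum_(i in C) f i + \esum_(i in D) f i =
  \esum_(i in C `|` D) f i + \esum_(i in C `&` D) f i.
Proof.
move=> f0; rewrite (esumID D (C `|` D)) // (esumID D C) //.
have -> : (C `|` D) `&` D = D by apply: setIidr; apply: subsetUr.
have -> : (C `|` D) `&` ~` D = C `&` ~` D.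
  by rewrite setIUl setICr setU0.
by rewrite addeC addeA [RHS]addeAC.
Qed.

End EsumExtra.

Section Cubes.
Context {R : realType} {n : nat}.
Implicit Types (m k : nat) (x y : 'rV[R]_n) (v : 'rV[int]_n).

Definition address m x : 'rV[int]_n := \row_i Num.floor (2 ^+ m * x 0 i).

Definition cube (c : nat * 'rV[int]_n) : set 'rV[R]_n :=
  [set x | address c.1 x = c.2].

(** Comparing with an integer commutes with rescaling by a power of two; hence
    the address at a level is determined by the address at any finer level. *)
Lemma address_ge m k x (z : int) i :
  (z <= address m x 0 i) = (2 ^+ k * z <= address (m + k) x 0 i).
Proof.
rewrite !mxE !floor_ge_int.
have -> : (2 ^+ k * z)%:~R = 2 ^+ k * z%:~R :> R by rewrite intrM rmorphXn.
by rewrite exprD -mulrA mulrCA ler_pM2l ?exprn_gt0.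
Qed.

Lemma address_coarsen m k x y :
  address (m + k) x = address (m + k) y -> address m x = address m y.
Proof.
move=> xy; apply/rowP => i; apply/eqP; rewrite eq_le.
by rewrite (address_ge _ k) -xy -address_ge lexx (address_ge _ k) xy -address_ge lexx.
Qed.

Lemma cube_nested (c d : nat * 'rV[int]_n) x : (c.1 <= d.1)%N ->
  cube c x -> cube d x -> cube d `<=` cube c.
Proof.
move=> cd cx dx y dy; rewrite /cube /= -cx; apply: (@address_coarsen _ (d.1 - c.1)).
by rewrite subnKC // dx.
Qed.

Lemma cube_inj (c d : nat * 'rV[int]_n) x : c.1 = d.1 ->
  cube c x -> cube d x -> c = d.
Proof. by case: c d => [m v] [k w]; rewrite /cube /= => -> <- <-. Qed.

End Cubes.

(** * Net contents *)

Section NetContent.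
Context {R : realType} {n : nat}.
Local Open Scope ereal_scope.
Implicit Types (s : R) (A B : set 'rV[R]_n) (c : nat * 'rV[int]_n)
  (C D : set (nat * 'rV[int]_n)).

Definition cube_weight s c : \bar R := (2 `^ (- (s * c.1%:R)))%:E.

Definition net_cost s C := \esum_(c in C) cube_weight s c.

Definition cubes C : set 'rV[R]_n := \bigcup_(c in C) cube c.

(** The dyadic-net analogue of Hausdorff content.  Covers are sets of cubes
    rather than sequences, so that they can be split and merged freely; there is
    no bound on the size of the cubes beyond side one. *)
Definition net_content s A :=
  ereal_inf [set net_cost s C | C in [set C | A `<=` cubes C]].

Lemma cube_weight_ge0 s c : 0 <= cube_weight s c.
Proof. by rewrite lee_fin powR_ge0. Qed.
Hint Resolve cube_weight_ge0 : core.

Lemma net_cost_ge0 s C : 0 <= net_cost s C.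
Proof. exact: esum_ge0. Qed.

Lemma net_content_ge0 s A : 0 <= net_content s A.
Proof. by apply: le_ereal_inf_tmp => _ [C _ <-]; exact: net_cost_ge0. Qed.

Lemma net_content_le_cost s A C : A `<=` cubes C -> net_content s A <= net_cost s C.
Proof. by move=> AC; apply: ereal_inf_lbound; exists C. Qed.

Lemma le_net_content s A B : A `<=` B -> net_content s A <= net_content s B.
Proof.
move=> AB; apply: ereal_inf_le_tmp => _ [C BC <-].
by exists C => //; apply: subset_trans BC.
Qed.

Lemma net_content0 s : net_content s set0 = 0.
Proof.
apply/eqP; rewrite eq_le net_content_ge0 andbT.
by rewrite -(esum_set0 (cube_weight s)); apply: net_content_le_cost.
Qed.

Lemma net_content_cube s c : net_content s (cube c) <= cube_weight s c.
Proof.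
rewrite -(@esum_set1 _ _ c (cube_weight s)) //; apply: net_content_le_cost.
by rewrite /cubes bigcup_set1.
Qed.

Lemma net_content_bigcup s (B : nat -> set 'rV[R]_n) :
  net_content s (\bigcup_k B k) <= \sum_(0 <= k <oo) net_content s (B k).
Proof.
have [[k Bk]|/forallNP Boo] := pselect (exists k, net_content s (B k) = +oo).
  suff -> : \sum_(0 <= k <oo) net_content s (B k) = +oo by rewrite leey.
  apply/eqP; rewrite -leye_eq -Bk (@nneseriesD1 _ _ k) //.
    by rewrite leeDl // nneseries_ge0 // => *; exact: net_content_ge0.
  by move=> *; exact: net_content_ge0.
apply/lee_addgt0Pr => e e0.
apply: le_trans (epsilon_trick _ _ (ltW e0)); last by move=> *; exact: net_content_ge0.
have /choice[C HC] k : exists C, B k `<=` cubes C /\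
    net_cost s C <= net_content s (B k) + (e / (2 ^ k.+1)%:R)%:E.
  have fin : net_content s (B k) \is a fin_num.
    by rewrite ge0_fin_numE ?net_content_ge0 // ltey; apply/eqP.
  have ek : (0 < e / (2 ^ k.+1)%:R)%R by rewrite divr_gt0 // ltr0n expn_gt0.
  have [_ [C BC <-] /ltW le] := lb_ereal_inf_adherent ek fin.
  by exists C.
apply: le_trans (_ : net_cost s (\bigcup_k C k) <= _).
  apply: net_content_le_cost => x [k _ Bx]; have [c Cc cx] := (HC k).1 x Bx.
  by exists c => //; exists k.
apply: le_trans (esum_bigcup_le _ _) _ => //.
by apply: lee_nneseries => [k _ _|k _]; [exact: esum_ge0 | exact: (HC k).2].
Qed.

Lemma net_contentU s A B : net_content s (A `|` B) <= net_content s A + net_content s B.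
Proof.
apply: le_trans (_ : net_content s (\bigcup_k (if k == 0%N then A else if k == 1%N then B else set0)) <= _).
  by apply: le_net_content => x [Ax|Bx]; [exists 0%N | exists 1%N].
apply: le_trans (net_content_bigcup _ _) _.
rewrite (nneseries_split 0 2) /=; last by move=> *; exact: net_content_ge0.
rewrite !big_nat_recr //= big_nil add0r eseries0 ?adde0 //.
move=> [|[|k]] //= _ _; exact: net_content0.
Qed.

(** Finite subadditivity is the only additivity the construction of hitting sets
    requires of a mass; in particular no Frostman measure has to be produced. *)
Lemma net_content_bigsetU s (I : finType) (B : I -> set 'rV[R]_n) A :
  A `<=` \bigcup_i B i -> net_content s A <= \sum_i net_content s (B i).
Proof.
move=> AB; have {}AB : A `<=` \big[setU/set0]_(i <- index_enum I) B i.
  move=> x /AB[i _ Bix]; rewrite -bigcup_seq; exists i => //=.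
  exact: mem_index_enum.
apply: (le_trans (le_net_content s AB)).
elim: (index_enum I) => [|i r IH]; first by rewrite !big_nil net_content0.
rewrite !big_cons; apply: le_trans (net_contentU _ _ _) _.
by rewrite leeD2l.
Qed.

End NetContent.

(** * Continuity of net contents along increasing sequences *)

Section NetContinuity.
Context {R : realType} {n : nat}.
Local Open Scope ereal_scope.
Implicit Types (s : R) (A B : set 'rV[R]_n) (c : nat * 'rV[int]_n)
  (C D : set (nat * 'rV[int]_n)).
Hint Resolve cube_weight_ge0 : core.

(** As levels are natural numbers, the maximal cubes of a family still cover its
    union. *)
Definition maximal_cubes C : set (nat * 'rV[int]_n) :=
  [set c | C c /\ forall d, C d -> (d.1 < c.1)%N ->
             ~ (@cube R n c `<=` cube d)].

Lemma cubes_maximal C : @cubes R n C `<=` cubes (maximal_cubes C).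
Proof.
move=> x [c Cc cx].
pose P := [pred m | `[< exists c, [/\ C c, c.1 = m & @cube R n c x] >]].
have exP : exists m, P m by exists c.1; apply/asboolP; exists c.
have [m /asboolP[d [Cd <- dx]] dmin] := ex_minnP exP.
exists d => //; split => // e Ce ed de.
have : P e.1 by apply/asboolP; exists e; split => //; exact: de.
by move=> /dmin; rewrite leqNgt ed.
Qed.

(** Strong subadditivity at the level of covers.  Merge two covers and keep only
    the maximal cubes; a point covered twice lies in two nested cubes, so that the
    discarded cubes still cover the intersection of the two unions. *)
Lemma net_cost_maximalU s C D :
  net_cost s (maximal_cubes (C `|` D)) + @net_content R n s (cubes C `&` cubes D) <=
  net_cost s (maximal_cubes C) + net_cost s D.
Proof.
set C' := maximal_cubes C; set E := C' `|` D.
rewrite /net_cost esum_setUI // -/E (esumID (maximal_cubes E) E) //.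
rewrite -[leRHS]addeA; apply: leeD.
  apply: le_esum_subset => c [CDc cmax].
  have Ec : E c.
    case: CDc => [Cc|Dc]; [left|by right]; split => // d Cd; apply: cmax; by left.
  by split => //; split => // d [[Cd _]|Dd]; apply: cmax; [left|right].
apply: le_trans (_ : net_cost s ((E `&` ~` maximal_cubes E) `|` (C' `&` D)) <= _).
  apply: net_content_le_cost => x [/cubes_maximal[c C'c cx] [d Dd dx]].
  have [cd|dc|cd] := ltngtP c.1 d.1.
  - exists d => //; left; split; first by right.
    by move=> [_ /(_ c (or_introl C'c) cd)]; apply; apply: cube_nested cx dx; exact: ltnW.
  - exists c => //; left; split; first by left.
    by move=> [_ /(_ d (or_intror Dd) dc)]; apply; apply: cube_nested dx cx; exact: ltnW.
  - by exists c => //; right; split=> //; rewrite (cube_inj cd cx dx).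
by rewrite [leRHS]esum_setUI // leeDl // esum_ge0.
Qed.

(** Choose nearly optimal covers [C k] of [A k] and let [D k] collect the first
    ones.  By strong subadditivity the cost of the maximal cubes of [D k] exceeds
    the content of [A k] by at most the accumulated errors.  A finite set of
    maximal cubes of the whole collection consists of maximal cubes of some [D k],
    so the bound survives in the limit. *)
Lemma net_content_continuous s (A : nat -> set 'rV[R]_n) (r : R) :
  (forall k, A k `<=` A k.+1) -> (forall k, net_content s (A k) <= r%:E) ->
  net_content s (\bigcup_k A k) <= r%:E.
Proof.
move=> incA Ar; apply/lee_addgt0Pr => e e0.
have finA k : net_content s (A k) \is a fin_num.
  by rewrite ge0_fin_numE ?net_content_ge0 // (le_lt_trans (Ar k)) ?ltry.
have /choice[C HC] k : exists C, A k `<=` cubes C /\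
    net_cost s C <= net_content s (A k) + (e / 2 ^+ k.+1)%:E.
  have ek : (0 < e / 2 ^+ k.+1)%R by rewrite divr_gt0 // exprn_gt0.
  have [_ [C BC <-] /ltW le] := lb_ereal_inf_adherent ek (finA k).
  by exists C.
pose D k := [set c | exists2 i, (i <= k)%N & C i c].
have DS k : D k.+1 = D k `|` C k.+1.
  apply/seteqP; split=> c.
    move=> [i]; rewrite leq_eqVlt => /orP[/eqP -> |ik] Cc; first by right.
    by left; exists i.
  by move=> [[i ik Cc]|Cc]; [exists i => //; exact: leqW | exists k.+1].
have costD k : net_cost s (maximal_cubes (D k)) <=
    net_content s (A k) + (e * (1 - 1 / 2 ^+ k.+1))%:E.
  elim: k => [|k IH].
    apply: le_trans (_ : net_cost s (C 0%N) <= _).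
      by apply: le_esum_subset => c [[[|i] // _ Cc] _].
    apply: le_trans (HC 0%N).2 _; rewrite leeD2l // lee_fin expr1; lra.
  rewrite -(leeD2rE _ _ (finA k)); apply: le_trans (_ : net_cost s (maximal_cubes (D k.+1)) +
    net_content s (cubes (D k) `&` cubes (C k.+1)) <= _).
    rewrite leeD2l // le_net_content // => x Akx; split.
      by have [c Cc cx] := (HC k).1 _ Akx; exists c => //; exists k.
    exact: ((HC k.+1).1 _ (incA _ _ Akx)).
  rewrite DS; apply: le_trans (net_cost_maximalU _ _ _) _.
  apply: le_trans (leeD IH (HC k.+1).2) _.
  rewrite -(fineK (finA k)) -(fineK (finA k.+1)) -!EFinD lee_fin.
  set x := fine _; set y := fine _.
  have -> : (e / 2 ^+ k.+2 = e * (1 / 2 ^+ k.+1) / 2)%R.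
    by rewrite (exprS _ k.+1); field; rewrite expf_neq0.
  have -> : (1 / 2 ^+ k.+2 = (1 / 2 ^+ k.+1) / 2 :> R)%R.
    by rewrite (exprS _ k.+1); field; rewrite expf_neq0.
  by set z := (1 / _)%R; lra.
pose W := \bigcup_k C k.
apply: le_trans (_ : net_cost s (maximal_cubes W) <= _).
  apply: net_content_le_cost => x [k _ /((HC k).1)[c Cc cx]].
  by apply: cubes_maximal; exists c => //; exists k.
apply: ub_ereal_sup => _ [X [finX XW] <-].
have [K XK] : exists K, X `<=` D K.
  have [l Xl] := (finite_seqP X).1 finX.
  have {}XW : [set` l] `<=` W by rewrite -Xl => x /XW[].
  rewrite Xl; elim: l XW {Xl} => [|c l IH] XW; first by exists 0%N.
  have [|K HK] := IH; first by move=> x xl; apply: XW; rewrite /= inE; apply/orP; right.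
  have [k _ Ck] : W c by apply: XW; rewrite /= inE eqxx.
  exists (maxn k K) => x /=; rewrite inE => /orP[/eqP ->|/HK [i iK Ci]].
    by exists k => //; exact: leq_maxl.
  by exists i => //; rewrite (leq_trans iK) ?leq_maxr.
apply: le_trans (_ : net_cost s (maximal_cubes (D K)) <= _).
  apply: ereal_sup_ubound; exists X => //; split => // c Xc; split; first exact: XK.
  by move=> d [i _ Cd]; apply: (XW _ Xc).2; exists i.
apply: le_trans (costD K) _; apply: leeD => //.
rewrite lee_fin ler_piMr ?(ltW e0) // gerBl divr_ge0 // exprn_ge0 //.
Qed.

End NetContinuity.

(** * Suslin sets and capacitability *)

Section Suslin.
Context {T : topologicalType}.
Implicit Types (A : set T) (C : nat -> (nat -> nat) -> set T).

(** [C k f] stands for a closed set indexed by the first [k] values of [f]. *)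
Definition closed_scheme C :=
  (forall k f, closed (C k f)) /\
  (forall k f g, (forall i, (i < k)%N -> f i = g i) -> C k f = C k g).

Definition suslin A :=
  exists2 C, closed_scheme C & A = \bigcup_f \bigcap_k C k f.

Lemma closed_suslin A : closed A -> suslin A.
Proof.
move=> cA; exists (fun _ _ => A) => //; apply/seteqP; split=> [x Ax|x [_ _ /(_ 0%N)]].
  by exists (fun=> 0%N).
exact.
Qed.

Lemma suslin_bigcup (A : nat -> set T) :
  (forall p, suslin (A p)) -> suslin (\bigcup_p A p).
Proof.
move=> sA; have /choice[C HC] : forall p, exists C,
    closed_scheme C /\ A p = \bigcup_f \bigcap_k C k f.
  by move=> p; have [C ? ?] := sA p; exists C.
exists (fun k f => if k is k'.+1 then C (f 0%N) k' (fun i => f i.+1) else setT).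
  split=> [[|k] f|[|k] f g fg //]; first exact: closedT.
    exact: (HC _).1.1.
  by rewrite fg //; apply: (HC _).1.2 => i ik; apply: fg.
apply/seteqP; split=> x.
  move=> [p _]; rewrite (HC p).2 => -[f _ Hf].
  exists (fun i => if i is i'.+1 then f i' else p) => // -[|k] //= _; exact: Hf.
move=> [f _ Hf]; exists (f 0%N) => //; rewrite (HC _).2.
by exists (fun i => f i.+1) => // k _; exact: (Hf k.+1).
Qed.

(** One sequence [f] encodes a sequence of sequences through the pairing of
    natural numbers; [C p j] is imposed as soon as the first [k] values of [f]
    determine the first [j] values of the [p]-th sequence. *)
Lemma suslin_bigcap (A : nat -> set T) :
  (forall p, suslin (A p)) -> suslin (\bigcap_p A p).
Proof.
move=> sA; have /choice[C HC] : forall p, exists C,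
    closed_scheme C /\ A p = \bigcup_f \bigcap_k C k f.
  by move=> p; have [C ? ?] := sA p; exists C.
pose sub (p : nat) (f : nat -> nat) (i : nat) := f (pickle (p, i)).
exists (fun k f => \bigcap_(pj in [set pj : nat * nat |
    forall i, (i < pj.2)%N -> (pickle (pj.1, i) < k)%N]) C pj.1 pj.2 (sub pj.1 f)).
  split=> [k f|k f g fg].
    by apply: closed_bigI => pj _; exact: (HC _).1.1.
  apply: eq_bigcapr => pj Hpj; apply: (HC _).1.2 => i ij.
  by apply: fg; exact: Hpj.
apply/seteqP; split=> x.
  move=> Ax; have /choice[f Hf] : forall p, exists f, forall k, C p k f x.
    move=> p; have := Ax p I; rewrite (HC p).2 => -[f _ Hf].
    by exists f => k; exact: Hf.
  exists (fun m => if unpickle m is Some pi then f pi.1 pi.2 else 0%N) => //.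
  move=> k _ [p j] /= _; rewrite (_ : sub _ _ = f p) //.
  by apply/funext => i; rewrite /sub pickleK.
move=> [f _ Hf] p _; rewrite (HC p).2; exists (sub p f) => // j _.
apply: (Hf (\max_(i < j) pickle (p, i : nat)).+1 I (p, j)) => i ij /=.
by rewrite ltnS (bigop.leq_bigmax (Ordinal ij)).
Qed.

Lemma closure_bigcup_lt (N : nat) (A : nat -> set T) x :
  closure (\bigcup_(i < N) A i) x -> exists2 i, (i < N)%N & closure (A i) x.
Proof.
elim: N => [|N IH].
  by rewrite bigcup_mkord big_ord0 closure0.
rewrite bigcup_mkord big_ord_recr /= -bigcup_mkord closureU => -[/IH[i iN]|].
  by exists i => //; exact: leqW.
by exists N.
Qed.

(** Choquet's capacitability argument.  Bound the values of the parametrizing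
    sequences one after the other: raising the bound exhausts the current set, so
    continuity from below keeps [Phi] above [c] for some bound.  A point in all
    the closures admits, by Koenig's lemma (bounded values give finite branching),
    one sequence along which it belongs to all the sets of the scheme. *)
Lemma suslin_capacity (R : realType) (Phi : set T -> \bar R) (c : \bar R) A :
  (forall X Y, X `<=` Y -> (Phi X <= Phi Y)%E) ->
  (forall X : nat -> set T, (forall k, X k `<=` X k.+1) ->
     (c < Phi (\bigcup_k X k))%E -> exists k, (c < Phi (X k))%E) ->
  suslin A -> (c < Phi A)%E ->
  exists K : nat -> set T, [/\ forall k, K k.+1 `<=` K k,
    forall k, (c < Phi (K k))%E & \bigcap_k closure (K k) `<=` A].
Proof.
move=> mono cont [C [clC depC] AE] cA.
pose G (l : seq nat) := [set x | exists2 f : nat -> nat,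
   (forall i, (i < size l)%N -> (f i <= nth 0%N l i)%N) & forall j, C j f x].
have step l : exists m, (c < Phi (G l))%E -> (c < Phi (G (rcons l m)))%E.
  have [cl|] := pselect (c < Phi (G l))%E; last by exists 0%N.
  have [| |m] := cont (fun m => G (rcons l m)); last by exists m.
  - move=> m x [f Hf Cf]; exists f => // i; rewrite size_rcons ltnS => il.
    apply: leq_trans (Hf i _) _; first by rewrite size_rcons ltnS.
    by rewrite !nth_rcons; case: ltngtP il => // ->.
  - apply: lt_le_trans cl _; apply: mono => x [f Hf Cf].
    exists (f (size l)) => //; exists f => // i; rewrite size_rcons ltnS nth_rcons.
    by case: ltngtP => // [/Hf //|->].
have [m Hm] := choice step.
pose L := fix L k := if k is k'.+1 then rcons (L k') (m (L k')) else [::].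
have sL k : size (L k) = k by elim: k => //= k IH; rewrite size_rcons IH.
pose b i := m (L i).
have nL k i : (i < k)%N -> nth 0%N (L k) i = b i.
  elim: k => // k IH; rewrite ltnS leq_eqVlt /= nth_rcons sL => /orP[/eqP ->|ik].
    by rewrite ltnn eqxx.
  by rewrite ik IH.
exists (fun k => G (L k)); split.
- move=> k x [f Hf Cf]; exists f => // i; rewrite sL => ik.
  by have := Hf i; rewrite sL !nL ?leqW // => -> //; exact: leqW.
- elim=> [|k IH]; last exact: Hm.
  apply: lt_le_trans cA _; apply: mono => x; rewrite AE => -[f _ Cf].
  by exists f => // j; exact: Cf.
move=> x Gx.
pose H (s : seq nat) k := [set y | exists2 f : nat -> nat,
   (forall i, (i < size s)%N -> f i = nth 0%N s i) /\
   (forall i, (i < k)%N -> (f i <= b i)%N) & forall j, C j f y].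
have Hdec s k k' : (k <= k')%N -> H s k' `<=` H s k.
  move=> kk' y [f [fs fb] Cf]; exists f => //; split => // i ik.
  by apply: fb; exact: leq_trans ik kk'.
(* Koenig's lemma: a prefix all of whose bounded extensions accumulate at [x] can
   be prolonged. *)
have ext s : exists a, (forall k, closure (H s k) x) ->
    (forall k, closure (H (rcons s a) k) x).
  have [Ps|] := pselect (forall k, closure (H s k) x); last by exists 0%N.
  apply: contrapT => /forallNP noa.
  have /choice[ka Hka] : forall a, exists k, ~ closure (H (rcons s a) k) x.
    by move=> a; apply/existsNP => Ha; exact: (noa a).
  pose K := (maxn (size s).+1 (\max_(a < (b (size s)).+1) ka a))%N.
  have sK : (size s < K)%N by rewrite leq_maxl.
  have : closure (\bigcup_(a < (b (size s)).+1) H (rcons s a) K) x.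
    apply: (closure_subset _ (Ps K)) => y [f [fs fb] Cf].
    exists (f (size s)); first by rewrite /= ltnS fb.
    exists f => //; split => // i; rewrite size_rcons ltnS nth_rcons.
    by case: ltngtP => // [/fs //|->].
  move=> /closure_bigcup_lt[a ab]; apply: contra_not (Hka a).
  apply: closure_subset; apply: Hdec; apply: leq_trans (leq_maxr _ _).
  exact: (bigop.leq_bigmax (Ordinal ab)).
have [a Ha] := choice ext.
pose S := fix S k := if k is k'.+1 then rcons (S k') (a (S k')) else [::].
have sS k : size (S k) = k by elim: k => //= k IH; rewrite size_rcons IH.
have nS k i : (i < k)%N -> nth 0%N (S k) i = a (S i).
  elim: k => // k IH; rewrite ltnS leq_eqVlt /= nth_rcons sS => /orP[/eqP ->|ik].
    by rewrite ltnn eqxx.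
  by rewrite ik IH.
have PS : forall j k, closure (H (S j) k) x.
  elim=> [k|j IH]; last exact: Ha.
  apply: closure_subset (Gx k I) => y [f Hf Cf]; exists f => //; split => // i ik.
  by rewrite -(nL k) // Hf // sL.
rewrite AE; exists (fun i => a (S i)) => // j _.
rewrite ((closure_id _).1 (clC j _)); apply: closure_subset (PS j j) => y [f [fs _] Cf].
rewrite (depC j _ f) // => i ij; rewrite fs ?sS // nS //.
Qed.

(** The sets that are Suslin together with their complement form a sigma-algebra. *)
Lemma borel_suslin (A : set T) :
  (forall U, open U -> suslin U) -> borel_set A -> suslin A.
Proof.
move=> oS bA.
suff [] : suslin A /\ suslin (~` A) by [].
move: A bA; apply: smallest_sub; last first.
  by move=> U oU; split; [exact: oS|apply: closed_suslin; exact: open_closedC].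
split.
- split; first by apply: closed_suslin; exact: closed0.
  by rewrite setC0; apply: closed_suslin; exact: closedT.
- by move=> B [sB sCB]; rewrite setTD setCK.
- move=> B sB; split; first by apply: suslin_bigcup => k; exact: (sB k).1.
  by rewrite setC_bigcup; apply: suslin_bigcap => k; exact: (sB k).2.
Qed.

End Suslin.

Lemma open_suslin (R : realType) (T : pseudoMetricType R) (U : set T) :
  open U -> suslin U.
Proof.
move=> oU.
have -> : U = \bigcup_k closure [set x | ball x k.+1%:R^-1 `<=` U].
  apply/seteqP; split=> x; last first.
    move=> [k _ /(_ _ (nbhsx_ballx x k.+1%:R^-1 _))[|y [yU xy]]].
      by rewrite invr_gt0.
    exact/yU/ball_sym.
  rewrite openE in oU; move=> /oU /nbhs_ballP[e e0 xU].
  have [k _ ke] := (near_infty_natSinv_lt (PosNum e0)).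
  exists k => //; apply: subset_closure => /= y xy; apply: xU.
  by apply: le_ball xy; rewrite ltW //; exact: (ke k (leqnn k)).
by apply: suslin_bigcup => k; apply: closed_suslin; exact: closed_closure.
Qed.

(** * Subdivision of cubes and hitting families of translations *)

Section Tower.
Context {R : realType} {n : nat}.
Implicit Types (m T : nat) (v f : 'rV[int]_n) (x e : 'rV[R]_n).

Definition digits T := {ffun 'I_n -> 'I_(2 ^ T)}.

Definition child T v (u : digits T) : 'rV[int]_n :=
  \row_i (2 ^+ T * v 0 i + (u i)%:Z).

Definition grid_point m f : 'rV[R]_n := \row_i ((f 0 i)%:~R / 2 ^+ m).

Lemma exp2z T : (2 ^ T)%N = 2 ^+ T :> int.
Proof. by rewrite -[LHS]natz natrX. Qed.

Lemma card_digits T : #|{: digits T}| = (2 ^ (n * T))%N.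
Proof. by rewrite card_ffun !card_ord -expnM mulnC. Qed.

Lemma child_child m T v (w : digits m) (u : digits T) :
  exists w' : digits (m + T), child (child v w) u = child v w'.
Proof.
have lt i : (2 ^ T * w i + u i < 2 ^ (m + T))%N.
  have := ltn_ord (w i); have := ltn_ord (u i); rewrite expnD => a b.
  apply: (@leq_trans (2 ^ T * (w i).+1)); first by rewrite mulnS addnC ltn_add2r.
  by rewrite mulnC leq_mul2r b orbT.
exists [ffun i => Ordinal (lt i)]; apply/rowP => i; rewrite !mxE ffunE /=.
rewrite PoszD PoszM mulrDr addrA mulrA -exprD [(T + m)%N]addnC.
by rewrite exp2z.
Qed.

Lemma address_child m T v x : cube (m, v) x ->
  exists u : digits T, address (m + T) x = child v u.
Proof.
rewrite /cube /= => mx.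
have lo i : 2 ^+ T * v 0 i <= address (m + T) x 0 i by rewrite -address_ge mx.
have hi i : address (m + T) x 0 i < 2 ^+ T * v 0 i + 2 ^+ T.
  rewrite -{2}[2 ^+ T]mulr1 -mulrDr ltNge -address_ge mx -ltNge.
  by rewrite ltrDl.
have lt i : (`|(address (m + T) x 0 i - 2 ^+ T * v 0 i)%R| < 2 ^ T)%N.
  rewrite -ltz_nat gez0_abs ?subr_ge0 // ltrBlDl (lt_le_trans (hi i)) //.
  by rewrite lerD2l exp2z.
exists [ffun i => Ordinal (lt i)]; apply/rowP => i; rewrite [RHS]mxE ffunE /=.
by rewrite gez0_abs ?subr_ge0 // addrC subrK.
Qed.

(** Translations by points of the grid of level [m] permute the cubes of level [m]. *)
Lemma address_sub_grid_point m f x :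
  address m (x - grid_point m f) = address m x - f.
Proof.
apply/rowP => i; rewrite !mxE mulrBr mulrCA divff ?expf_neq0 // mulr1.
by rewrite floorDrz ?rpredN ?intr_int // -rmorphN intrKfloor.
Qed.

Definition digit_difference T (u u' : digits T) : 'rV[int]_n :=
  \row_i ((u i)%:Z - (u' i)%:Z).

(** A translation moves the subcube [u] to [u'] when it is the difference of their
    digits, so the family of differences from [u] to good subcubes must be hit for
    all parents [w] and all [u].  There are [2 ^ (n * (m + T))] such pairs, and
    differences range over a set of [2 ^ (n * T.+1)] elements. *)
Lemma exists_hitting_translations m T d (good : digits m -> {set digits T}) :
  (d <= n * T)%N ->
  exists F : seq 'rV[int]_n,
   [/\ (size F <= 2 ^ (n * T.+1 - d) * (n * (m + T)).+1)%N,
       forall f, f \in F -> forall i, `|f 0 i| <= 2 ^+ T &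
       forall w u, (2 ^ d <= #|good w|)%N ->
         exists2 u', u' \in good w & digit_difference u u' \in F].
Proof.
move=> dT.
(* Differences of digits are shifted by [2 ^ T] so as to be digits themselves. *)
have lt (u u' : digits T) i : (u i + 2 ^ T - u' i < 2 ^ T.+1)%N.
  have := ltn_ord (u i); rewrite expnS mul2n -addnn => a.
  by apply: leq_ltn_trans (leq_subr _ _) _; rewrite ltn_add2r.
pose code (u u' : digits T) : digits T.+1 := [ffun i => Ordinal (lt u u' i)].
pose decode (g : digits T.+1) : 'rV[int]_n := \row_i ((g i)%:Z - (2 ^ T)%:Z).
have codeK u u' : decode (code u u') = digit_difference u u'.
  apply/rowP => i; rewrite !mxE ffunE /=.
  by have := ltn_ord (u' i); lia.
have code_inj u : injective (code u).
  move=> u' u'' /(congr1 decode); rewrite !codeK => /rowP E.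
  by apply/ffunP => i; apply: val_inj => /=; have := E i; rewrite !mxE; lia.
pose S (wu : digits m * digits T) : {set digits T.+1} := code wu.2 @: good wu.1.
have [||F sF HF] := @exists_hitting _ _ S (n * (m + T)) (n * T.+1 - d) d.
- by rewrite subnK ?card_digits // (leq_trans dT) // leq_mul2l leqnSn orbT.
- by rewrite card_prod !card_digits -expnD mulnDr.
exists [seq decode g | g <- F]; split; first by rewrite size_map.
- move=> _ /mapP[g _ ->] i; rewrite mxE.
  case: (g i) => [k /= klt]; rewrite expnS in klt; rewrite -exp2z; lia.
- move=> w u; rewrite -(card_imset _ (code_inj u)) => wd.
  have /hasP[g gF /imsetP[u' u'w gE]] := HF (w, u) wd.
  exists u' => //; apply/mapP; exists g => //; rewrite gE codeK //.
Qed.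

End Tower.

Arguments digits n T : clear implicits.

(** * The tower of translations *)

Section HittingTower.
Context {R : realType} {n : nat}.
Implicit Types (m T j : nat) (v f : 'rV[int]_n) (x e : 'rV[R]_n).

(** Cubic growth makes the gaps negligible with respect to the levels, and yet so
    large that factors polynomial in [j] at each step multiply up to
    [2 ^ O(j ^ 2)], which is subexponential in the level. *)
Definition level j := (j ^ 3)%N.

Definition gap j := (level j.+1 - level j)%N.

Lemma level_gap j : (level j + gap j = level j.+1)%N.
Proof. by rewrite /gap subnKC // leq_exp2r. Qed.

Definition close_to j e (p : 'rV[R]_n) :=
  forall i, `|e 0 i - p 0 i| <= 2 * 2^-1 ^+ level j.

(** The factor lost in [mass_pigeonhole] at step [j]. *)
Definition step_loss j := (n * gap j).+2.

(** The number of values of [d] at step [j], times the excess of the size of a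
    hitting family over [2 ^ (n * gap j - d)]. *)
Definition step_growth j := ((n * gap j).+1 * 2 ^ n * (n * level j.+1).+1)%N.

Definition loss_rate := (4 * n + 15)%N.

Lemma step_bound j :
  (step_growth j * step_loss j <= 2 ^ (loss_rate * (2 * j).+1))%N.
Proof.
have gj : (gap j <= j.+1 ^ 3)%N by rewrite /gap /level leq_subr.
set X := (j.+1 ^ 3)%N in gj.
have X0 : (0 < X)%N by rewrite expn_gt0.
set Y := (n.+2 * X)%N.
have XY : (n * X + 2 <= Y)%N by rewrite /Y; nia.
have gY : (n * gap j + 2 <= Y)%N.
  by apply: leq_trans XY; rewrite leq_add2r leq_mul2l gj orbT.
apply: (@leq_trans (Y ^ 3 * 2 ^ n)).
  have -> : (Y ^ 3 = Y * (Y * Y))%N by rewrite !expnS expn0 muln1.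
  rewrite /step_growth /step_loss /level -/X.
  rewrite -[leqLHS]mulnA -[leqLHS]mulnA [leqLHS]mulnCA [leqLHS]mulnC.
  rewrite leq_mul2r; apply/orP; right.
  by do 2?[apply: leq_mul]; lia.
have Y2 : (Y <= 2 ^ (n.+2 + 3 * j.+1))%N.
  rewrite /Y /X expnD; apply: leq_mul; first by apply: ltnW; apply: ltn_expl.
  by rewrite mulnC expnM leq_exp2r //; apply: ltnW; apply: ltn_expl.
apply: (@leq_trans ((2 ^ (n.+2 + 3 * j.+1)) ^ 3 * 2 ^ n)).
  by rewrite leq_mul2r leq_exp2r // Y2 orbT.
rewrite -expnM -expnD leq_exp2l // /loss_rate; nia.
Qed.

Lemma prod_step_bound j :
  ((\prod_(i < j) step_growth i) * (\prod_(i < j) step_loss i) <=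
   2 ^ (loss_rate * j ^ 2))%N.
Proof.
elim: j => [|j IH]; first by rewrite !big_ord0 expn_gt0.
rewrite !big_ord_recr /= mulnACA.
have -> : (loss_rate * j.+1 ^ 2 = loss_rate * j ^ 2 + loss_rate * (2 * j).+1)%N.
  by rewrite -mulnDr; congr (_ * _)%N; rewrite !expnS !expn0; lia.
by rewrite expnD leq_mul // step_bound.
Qed.

(** An entry [(q, e)] records a translation [e] together with the total drop [q]
    in the exponent of the mass along the way. *)
Fixpoint tower (G : nat -> seq (nat * 'rV[int]_n)) j : seq (nat * 'rV[R]_n) :=
  if j is i.+1 then
    [seq ((p.1 + g.1)%N, p.2 + grid_point (level i.+1) g.2) | p <- tower G i, g <- G i]
  else [:: (0%N, 0)].

(** A drop by [d] is paid by a family of translations that is [2 ^ d] times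
    smaller, so it is the count weighted by [2 ^ q] that grows like the number of
    cubes. *)
Lemma tower_weight G j :
  (forall i, \sum_(g <- G i) 2 ^ g.1 <= 2 ^ (n * gap i) * step_growth i)%N ->
  (\sum_(p <- tower G j) 2 ^ p.1 <= 2 ^ (n * level j) * \prod_(i < j) step_growth i)%N.
Proof.
move=> HG; elim: j => [|j IH].
  by rewrite big_seq1 big_ord0 /level muln0.
rewrite /= big_allpairs_dep /= big_ord_recr /= -level_gap mulnDr expnD mulnACA.
apply: leq_trans (leq_mul IH (HG j)); rewrite big_distrl /=.
by apply: leq_sum => p _; rewrite big_distrr /=; apply: leq_sum => g _; rewrite expnD.
Qed.

Variables (v0 : 'rV[int]_n) (s c : R) (mu : nat -> 'rV[int]_n -> R).
Hypothesis c_gt0 : 0 < c.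
Hypothesis mu_root : c <= mu 0%N v0.
Hypothesis mu_le : forall m v, mu m v <= 2 `^ (- (s * m%:R)).
Hypothesis mu_sub : forall m T v,
  mu m v <= \sum_(u : digits n T) mu (m + T)%N (child v u).

(** From a cube of positive mass, [mass_pigeonhole] selects a drop [d] with at
    least [2 ^ d] heavy children; the hitting family for that [d] contains a
    translation into one of them. *)
Lemma exists_step j : exists G : seq (nat * 'rV[int]_n),
  [/\ (\sum_(g <- G) 2 ^ g.1 <= 2 ^ (n * gap j) * step_growth j)%N,
      forall g, g \in G -> forall i, `|g.2 0 i| <= 2 ^+ gap j &
      forall (w : digits n (level j)) (u : digits n (gap j)), 0 < mu (level j) (child v0 w) ->
        exists2 g, g \in G & exists2 u', g.2 = digit_difference u u' &
          mu (level j) (child v0 w) / ((step_loss j)%:R * 2 ^+ g.1) <=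
          mu (level j.+1) (child (child v0 w) u')].
Proof.
set N := (n * gap j)%N.
pose good d (w : digits n (level j)) : {set digits n (gap j)} :=
  [set u' | (mu (level j) (child v0 w) / (N.+2%:R * 2 ^+ d) <=
             mu (level j + gap j) (child (child v0 w) u'))%R]%SET.
have /choice[F HF] d : exists F : seq 'rV[int]_n, (d <= N)%N ->
  [/\ (size F <= 2 ^ (n * (gap j).+1 - d) * (n * level j.+1).+1)%N,
      forall f, f \in F -> forall i, `|f 0 i| <= 2 ^+ gap j &
      forall w (u : digits n (gap j)), (2 ^ d <= #|good d w|)%N ->
        exists2 u', u' \in good d w & digit_difference u u' \in F].
  have [dN|_] := leqP d N; last by exists [::].
  have [F HF] := exists_hitting_translations (good d) dN; exists F => _.
  by rewrite level_gap in HF.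
exists [seq (d, f) | d <- iota 0 N.+1, f <- F d]; split.
- rewrite big_allpairs_dep.
  apply: (@leq_trans (\sum_(d <- iota 0 N.+1) 2 ^ (n * (gap j).+1) * (n * level j.+1).+1)).
    rewrite big_seq [leqRHS]big_seq; apply: leq_sum => d; rewrite mem_iota add0n ltnS => dN.
    rewrite big_const_seq count_predT iter_addn_0.
    have [sF _ _] := HF d dN; apply: leq_trans (leq_mul (leqnn _) sF) _.
    rewrite mulnA -expnD subnKC // (leq_trans dN) // leq_mul2l leqnSn orbT //.
  rewrite big_const_seq count_predT size_iota iter_addn_0 /step_growth.
  have -> : (n * (gap j).+1 = n * gap j + n)%N by rewrite mulnS addnC.
  rewrite expnD.
  by apply: eq_leq; rewrite -/N; ring.
- move=> _ /allpairsPdep[d [f [+ fF ->]]] i; rewrite mem_iota add0n ltnS /= => dN.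
  by have [_ + _] := HF d dN; apply.
move=> w u mu0; have [d dN Hd] := mass_pigeonhole (eq_leq (@card_digits n (gap j)))
  mu0 (mu_sub (level j) (gap j) (child v0 w)).
have [_ _ /(_ w u Hd)[u' + uF]] := HF d dN; rewrite inE level_gap => Hu'.
exists (d, digit_difference u u'); last by exists u'.
apply/allpairsPdep; exists d, (digit_difference u u'); split => //.
by rewrite mem_iota add0n ltnS.
Qed.


(** The drop that a cube of level [level j] must have undergone, as its mass is at
    most [2 `^ (- (s * (level j)%:R))]. *)
Definition admissible j q :=
  c * 2 `^ (s * (level j)%:R) <= 2 ^+ q * (\prod_(i < j) step_loss i)%:R.

(** Admissible drops satisfy [2 ^ q >= 2 ^ (s * level j)] up to subexponential
    factors, so the weighted count [tower_weight] leaves at most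
    [2 ^ ((n - s) * level j)] of them. *)
Lemma size_admissible G j :
  (forall i, \sum_(g <- G i) 2 ^ g.1 <= 2 ^ (n * gap i) * step_growth i)%N ->
  (size [seq p <- tower G j | admissible j p.1])%:R <=
  c^-1 * 2 `^ ((n%:R - s) * (level j)%:R + (loss_rate * j ^ 2)%:R) :> R.
Proof.
move=> HG; set l := seq.filter _ _.
have c2 : 0 < c * 2 `^ (s * (level j)%:R) by rewrite mulr_gt0 // powR_gt0.
rewrite -(ler_pM2r c2).
apply: le_trans (_ : \sum_(p <- l) 2 ^+ p.1 * (\prod_(i < j) step_loss i)%:R <= _).
  rewrite (_ : (size l)%:R = \sum_(p <- l) 1); last first.
    by rewrite big_const_seq count_predT iter_addr_0.
  rewrite mulr_suml big_seq [leRHS]big_seq; apply: ler_sum => p.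
  by rewrite mem_filter mul1r => /andP[].
rewrite -mulr_suml.
apply: le_trans (_ : (2 ^ (n * level j) * 2 ^ (loss_rate * j ^ 2))%:R <= _).
  apply: le_trans (_ : ((\sum_(p <- tower G j) 2 ^ p.1) * \prod_(i < j) step_loss i)%:R <= _).
    rewrite natrM ler_wpM2r // natr_sum big_filter big_mkcond /=.
    by apply: ler_sum => p _; case: ifP => _ //; rewrite natrX.
  rewrite ler_nat; apply: leq_trans (leq_mul (tower_weight _ HG) (leqnn _)) _.
  by rewrite -mulnA leq_mul2l prod_step_bound orbT.
rewrite mulrCA !mulrA divff ?gt_eqF // mul1r.
rewrite -powRD; last by rewrite pnatr_eq0 implybT.
rewrite -expnD natrX -powR_mulrn // ler_powR // ?ler1n // natrD natrM.
lra.
Qed.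


End HittingTower.

Arguments step_loss n j : clear implicits.
Arguments step_growth n j : clear implicits.
Arguments loss_rate n : clear implicits.
Arguments admissible {R} n s c j q.

(** * Paths through the tower and their limits *)

Section TowerPath.
Context {R : realType} {n : nat}.
Implicit Types (m T j : nat) (v f : 'rV[int]_n) (x e : 'rV[R]_n).
Variables (v0 : 'rV[int]_n) (s c : R) (mu : nat -> 'rV[int]_n -> R).
Hypothesis c_gt0 : 0 < c.
Hypothesis mu_root : c <= mu 0%N v0.
Hypothesis mu_le : forall m v, mu m v <= 2 `^ (- (s * m%:R)).
Hypothesis mu_sub : forall m T v,
  mu m v <= \sum_(u : digits n T) mu (m + T)%N (child v u).

Lemma step_loss_gt0 j : 0 < (\prod_(i < j) step_loss n i)%:R :> R.
Proof. by rewrite ltr0n prodn_gt0. Qed.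

(** The translate of [x] lies in a descendant of the root cube whose mass is at
    least [c / 2 ^ q], up to the losses. *)
Definition on_path (G : nat -> seq (nat * 'rV[int]_n)) x j (p : nat * 'rV[R]_n) :=
  p \in tower G j /\
  exists w : digits n (level j), cube (level j, child v0 w) (x - p.2) /\
    c <= mu (level j) (child v0 w) * (2 ^+ p.1 * (\prod_(i < j) step_loss n i)%:R).

Lemma on_path_admissible G x j p : on_path G x j p -> admissible n s c j p.1.
Proof.
move=> [_ [w [_ cw]]]; rewrite /admissible -ler_pdivlMr ?powR_gt0 // -powRN.
by apply: le_trans cw _; rewrite mulrC ler_wpM2l //.
Qed.

Lemma on_path_step (G : nat -> seq (nat * ('rV[int]_n))) x j (p : nat * 'rV[R]_n) :
  (forall i g, g \in G i -> forall k, `|g.2 0 k| <= 2 ^+ gap i) ->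
  (forall j (w : digits n (level j)) (u : digits n (gap j)),
     0 < mu (level j) (child v0 w) ->
        exists2 g, g \in G j & exists2 u', g.2 = digit_difference u u' &
          mu (level j) (child v0 w) / ((step_loss n j)%:R * 2 ^+ g.1) <=
          mu (level j.+1) (child (child v0 w) u')) ->
  on_path G x j p -> exists2 p', on_path G x j.+1 p' &
    forall i, `|p'.2 0 i - p.2 0 i| <= 2^-1 ^+ level j.
Proof.
move=> Gb Gs [pG [w [xw cw]]].
have [u Hu] := address_child (gap j) xw.
have P0 : 0 < 2 ^+ p.1 * (\prod_(i < j) step_loss n i)%:R :> R.
  by rewrite mulr_gt0 ?exprn_gt0 // step_loss_gt0.
have mu0 : 0 < mu (level j) (child v0 w).
  by rewrite -(pmulr_lgt0 _ P0); exact: lt_le_trans cw.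
have [g gG [u' gu' Hmu]] := Gs j w u mu0.
exists ((p.1 + g.1)%N, p.2 + grid_point (level j.+1) g.2); last first.
  move=> i /=; rewrite !mxE addrAC subrr add0r -level_gap normrM -intr_norm.
  rewrite [X in _ * X]ger0_norm ?invr_ge0 ?exprn_ge0 // exprD invfM mulrA mulrAC.
  rewrite exprVn ler_piMl ?invr_ge0 ?exprn_ge0 //.
  rewrite ler_pdivrMr ?exprn_gt0 // mul1r.
  have := Gb j g gG i; rewrite -(ler_int R) => /le_trans; apply.
  by rewrite rmorphXn.
split; first by apply/allpairsP; exists (p, g).
have [w' Hw'] := child_child v0 w u'; rewrite level_gap in w' Hw'.
exists w'; rewrite -Hw'; split.
  rewrite /cube /= opprD addrA address_sub_grid_point -{1}level_gap Hu gu'.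
  by apply/rowP => i; rewrite !mxE; ring.
rewrite /= big_ord_recr /= exprD natrM.
apply: le_trans cw _.
have := Hmu; rewrite ler_pdivrMr ?mulr_gt0 ?exprn_gt0 ?ltr0n // => {}Hmu.
rewrite -(ler_pM2r P0) in Hmu; apply: le_trans Hmu _.
by rewrite le_eqVlt; apply/orP; left; apply/eqP; ring.
Qed.

Lemma on_path_root G x : cube (0%N, v0) x -> on_path G x 0 (0%N, 0).
Proof.
move=> x0; split; first by rewrite inE.
have lt1 : (0 < 2 ^ level 0)%N by [].
exists [ffun=> Ordinal lt1].
have -> : child v0 [ffun=> Ordinal lt1] = v0 :> 'rV[int]_n.
  by apply/rowP => i; rewrite !mxE ffunE expr0 mul1r addr0.
by rewrite subr0 expr0 big_ord0 !mulr1.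
Qed.

Lemma level_lt j : (level j < level j.+1)%N.
Proof. by rewrite /level ltn_exp2r. Qed.

(** The steps decrease so fast that the intervals of radius [2 * 2^-1 ^+ level j]
    around the coordinates of [e j] are nested; the suprema of their left ends lie
    in all of them. *)
Lemma tower_limit (e : nat -> 'rV[R]_n) :
  (forall j i, `|e j.+1 0 i - e j 0 i| <= 2^-1 ^+ level j) ->
  exists e', forall j, close_to j e' (e j).
Proof.
move=> He.
pose del j : R := 2 * 2^-1 ^+ level j.
(* The radii leave room for the next step because levels increase strictly. *)
have delS j : 2^-1 ^+ level j <= del j - del j.+1.
  rewrite /del -(subnKC (level_lt j)) addSnnS exprD.
  set y := 2^-1 ^+ level j; have y0 : 0 <= y by rewrite exprn_ge0.
  have : 2^-1 ^+ (level j.+1 - (level j).+1).+1 <= 2^-1 :> R.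
    by rewrite exprS ler_piMr // exprn_ile1 // invf_le1 // ler1n.
  by move=> /(ler_wpM2l y0); lra.
have lower i j k : e j 0 i - del j <= e (j + k)%N 0 i - del (j + k)%N.
  elim: k => [|k IH]; first by rewrite addn0.
  apply: le_trans IH _; rewrite addnS; have := delS (j + k)%N.
  by have := He (j + k)%N i; rewrite ler_norml => /andP[]; lra.
have upper i j k : e (j + k)%N 0 i + del (j + k)%N <= e j 0 i + del j.
  elim: k => [|k IH]; first by rewrite addn0.
  apply: le_trans IH; rewrite addnS; have := delS (j + k)%N.
  by have := He (j + k)%N i; rewrite ler_norml => /andP[]; lra.
have del0 j : 0 <= del j by rewrite mulr_ge0 // exprn_ge0.
have cross i j k : e j 0 i - del j <= e k 0 i + del k.
  have [jk|/ltnW kj] := leqP j k.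
    by have := lower i j (k - j)%N; rewrite subnKC //; have := del0 k; lra.
  by have := upper i k (j - k)%N; rewrite subnKC //; have := del0 j; lra.
pose L i := [set e j 0 i - del j | j in setT].
have Lub i k : ubound (L i) (e k 0 i + del k) by move=> _ [j _ <-]; exact: cross.
have Lne i : L i !=set0 by exists (e 0%N 0 i - del 0%N); exists 0%N.
exists (\row_i sup (L i)) => j i; rewrite mxE ler_norml.
have lo : e j 0 i - del j <= sup (L i).
  by apply: ub_le_sup; [exists (e 0%N 0 i + del 0%N) | exists j].
have hi : sup (L i) <= e j 0 i + del j by apply: ge_sup.
by rewrite -/(del j); apply/andP; split; lra.
Qed.

(** Every point of the root cube is translated, along some path of the tower, into
    cubes of positive mass at all levels. *)
Theorem hitting_tower : exists P : nat -> seq 'rV[R]_n,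
  (forall j, (size (P j))%:R <=
     c^-1 * 2 `^ ((n%:R - s) * (level j)%:R + (loss_rate n * j ^ 2)%:R) :> R) /\
  forall x, cube (0%N, v0) x -> exists e, forall j, exists2 p, p \in P j &
    close_to j e p /\ exists2 v, 0 < mu (level j) v & cube (level j, v) (x - p).
Proof.
have /choice[G HG] := fun j => exists_step v0 mu_sub j.
exists (fun j => [seq p.2 | p <- tower G j & admissible n s c j p.1]).
split=> [j|x x0].
  by rewrite size_map; apply: size_admissible => // i; have [] := HG i.
have step j p : exists p', on_path G x j p -> on_path G x j.+1 p' /\
    forall i, `|p'.2 0 i - p.2 0 i| <= 2^-1 ^+ level j.
  have [xp|] := pselect (on_path G x j p); last by exists p.
  have [||p' ? ?] := on_path_step _ _ xp; last by exists p'.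
    by move=> i; have [] := HG i.
  by move=> i; have [] := HG i.
have {}step jp : exists p', on_path G x jp.1 jp.2 -> on_path G x jp.1.+1 p' /\
    forall i, `|p'.2 0 i - jp.2.2 0 i| <= 2^-1 ^+ level jp.1 by exact: step.
have [h Hh] := choice step.
pose q := fix q j := if j is i.+1 then h (i, q i) else (0%N, 0).
have qP j : on_path G x j (q j).
  elim: j => [|j IH]; first exact: on_path_root.
  exact: (Hh (j, q j) IH).1.
have [e He] := tower_limit (fun j => (Hh (j, q j) (qP j)).2).
exists e => j; exists (q j).2; last split; last 2 first.
- exact: He.
- have [_ [w [xw cw]]] := qP j; exists (child v0 w) => //.
  have P0 : 0 < 2 ^+ (q j).1 * (\prod_(i < j) step_loss n i)%:R :> R.
    by rewrite mulr_gt0 ?exprn_gt0 // step_loss_gt0.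
  by rewrite -(pmulr_lgt0 _ P0); exact: lt_le_trans cw.
- apply: map_f; rewrite mem_filter (on_path_admissible (qP j)).
  exact: (qP j).1.
Qed.

End TowerPath.

(** * Asymptotics of covering numbers *)

Section MinkowskiDimension.
Context {R : realType} {n : nat}.
Implicit Types (E U : set 'rV[R]_n) (d a : R).

Lemma covering_number_anti d d' E : d <= d' ->
  (covering_number d' E <= covering_number d E)%E.
Proof.
move=> dd'; apply: ereal_inf_le_tmp => _ [k [U [EU dU]] <-]; exists k => //.
by exists U; split => // i; apply: le_trans (dU i) _; rewrite lee_fin.
Qed.

Lemma covering_number_ge1 d E : E !=set0 -> (1 <= covering_number d E)%E.
Proof.
move=> [x Ex]; apply: le_ereal_inf_tmp => _ [k [U [EU _]] <-].
rewrite lee_fin ler1n; case: k U EU => // U /(_ x Ex) [[]] //.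
Qed.

(** The excess [e * i ^ 3] absorbs the difference of consecutive cubes and all
    lower-order terms. *)
Lemma cubic_dominates (a e C D : R) (B : R) : 0 <= a -> 0 < e -> exists I : nat,
  forall i, (I <= i)%N ->
    C + (a * (i.+1 ^ 3)%:R + D * (i.+1 ^ 2)%:R) <= (a + e) * ((i ^ 3)%:R - B).
Proof.
move=> a0 e0; pose M := 7 * a + 4 * `|D| + `|C| + (a + e) * `|B|.
have M0 : 0 <= M.
  by rewrite !addr_ge0 // ?mulr_ge0 // ?addr_ge0 // ltW.
exists (Num.truncn (M / e)).+1 => i Ii.
have ie : M <= i%:R * e.
  rewrite -ler_pdivrMr //; apply: le_trans (ltW (truncnS_gt _)) _.
  by rewrite ler_nat.
have i1 : 1 <= i%:R :> R by rewrite ler1n (leq_trans _ Ii).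
rewrite !natrX -natr1; set x := i%:R in ie i1 *.
have x2 : 1 <= x ^+ 2 by rewrite exprn_ege1.
have h1 : a * (x + 1) ^+ 3 <= a * x ^+ 3 + 7 * a * x ^+ 2.
  have : (x + 1) ^+ 3 <= x ^+ 3 + 7 * x ^+ 2 by nra.
  by move=> /(ler_wpM2l a0); lra.
have h2 : D * (x + 1) ^+ 2 <= 4 * `|D| * x ^+ 2.
  apply: (@le_trans _ _ (`|D| * (x + 1) ^+ 2)).
    by rewrite ler_wpM2r ?ler_norm // sqr_ge0.
  have : (x + 1) ^+ 2 <= 4 * x ^+ 2 by nra.
  by move=> /(ler_wpM2l (normr_ge0 D)); lra.
have h3 : C <= `|C| * x ^+ 2.
  by apply: le_trans (ler_norm C) _; rewrite ler_peMr.
have h4 : (a + e) * B <= (a + e) * `|B| * x ^+ 2.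
  apply: (@le_trans _ _ ((a + e) * `|B|)).
    by rewrite ler_wpM2l ?ler_norm // addr_ge0 // ltW.
  by rewrite ler_peMr // mulr_ge0 // addr_ge0 // ltW.
have h5 : M * x ^+ 2 <= e * x ^+ 3.
  by have := ler_wpM2r (sqr_ge0 x) ie; lra.
rewrite /M in h5; lra.
Qed.

Lemma level_ge j : (j <= level j)%N.
Proof. by rewrite /level; case: j => // j; rewrite -{1}(expn1 j.+1) leq_pexp2l. Qed.

Lemma le_side i j : (i <= j)%N -> 2^-1 ^+ level j <= 2^-1 ^+ level i :> R.
Proof.
by move=> ij; rewrite ler_wiXn2l ?invf_le1 ?ler1n // /level leq_exp2r.
Qed.

Lemma exists_side_lt (x : R) : 0 < x -> exists j, 2^-1 ^+ level j < x.
Proof.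
move=> x0; pose j := (Num.truncn x^-1).+1; exists j.
rewrite -[ltRHS]invrK exprVn ltf_pV2 ?posrE ?invr_gt0 ?exprn_gt0 //.
apply: lt_le_trans (truncnS_gt _) _; rewrite -natrX ler_nat.
by apply: ltnW; apply: leq_ltn_trans (level_ge j) (ltn_expl _ _).
Qed.

(** For a radius between [K * 2^-1 ^+ level i.+1] and [K * 2^-1 ^+ level i] use the
    covering number at the smaller end; consecutive levels have ratio tending to
    one, so nothing is lost in the exponent. *)
Lemma upper_minkowski_dim_le E (a C K : R) (D : nat) : E !=set0 ->
  0 <= a -> 0 < C -> 0 < K ->
  (forall j, (covering_number (K * 2^-1 ^+ level j) E <=
     (C * 2 `^ (a * (level j)%:R + (D * j ^ 2)%:R))%:E)%E) ->
  (upper_minkowski_dim E <= a%:E)%E.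
Proof.
move=> E0 a0 C0 K0 HE; apply/lee_addgt0Pr => e e0.
have l2 : 0 < ln (2 : R) by rewrite ln_gt0 // ltr1n.
have [I HI] := cubic_dominates (ln C / ln 2) D%:R (ln K / ln 2) a0 e0.
pose del := Num.min 1 (K * 2^-1 ^+ level I).
have del0 : 0 < del by rewrite lt_min ltr01 mulr_gt0 // exprn_gt0.
apply: ge_ereal_inf.
exists (ereal_sup [set (lne (covering_number d E) * ((- ln d)^-1)%:E)%E | d in
   [set d | 0 < d < del]]).
  exists [set d | 0 < d < del] => //.
  near=> d; apply/andP; split; near: d; [exact: nbhs_right_gt|exact: nbhs_right_lt].
apply: ub_ereal_sup => _ [d /andP[d0 dd] <-].
have [d1 dI] : d < 1 /\ d < K * 2^-1 ^+ level I.
  by move: dd; rewrite lt_min => /andP.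
have exj : exists j, K * 2^-1 ^+ level j <= d.
  have [j jd] := exists_side_lt (divr_gt0 d0 K0); exists j.
  by rewrite mulrC -ler_pdivlMr // ltW.
(* The first level at which the cubes become smaller than [d]. *)
have [[|i]] := ex_minnP exj.
  move=> d'; have := lt_le_trans dI (ler_wpM2l (ltW K0) (le_side (leq0n I))).
  by rewrite ltNge d'.
move=> id imin.
have di : d < K * 2^-1 ^+ level i.
  by rewrite ltNge; apply/negP => /imin; rewrite ltnn.
have Ii : (I <= i)%N.
  rewrite leqNgt; apply/negP => iI.
  have := lt_le_trans dI (ler_wpM2l (ltW K0) (le_side iI)).
  by rewrite ltNge id.
have lnd : 0 < - ln d by rewrite oppr_gt0 ln_lt0 // d0.
have := le_trans (covering_number_anti E id) (HE i.+1).
have N1 := covering_number_ge1 d E0.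
case: (covering_number d E) N1 => [N|_|] //.
rewrite !lee_fin => N1 HN.
have N0 : 0 < N by exact: lt_le_trans N1.
rewrite lne_EFin // -EFinM -EFinD lee_fin ler_pdivrMr //.
have NB : ln N <= ln C + (a * (level i.+1)%:R + (D * i.+1 ^ 2)%:R) * ln 2.
  rewrite -ln_powR -lnM ?posrE ?powR_gt0 // ler_ln ?posrE //.
  by rewrite mulr_gt0 // powR_gt0.
have dB : (level i)%:R * ln 2 - ln K <= - ln d.
  rewrite -lerN2 opprK opprB; apply: le_trans (_ : ln (K * 2^-1 ^+ level i) <= _).
    by rewrite ler_ln ?posrE ?ltW // mulr_gt0 // exprn_gt0.
  by rewrite lnM ?posrE ?exprn_gt0 // lnXn // lnV ?posrE // mulNrn mulr_natl.
apply: (le_trans NB).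
have := HI i Ii; rewrite -(ler_pM2r l2) => HIi.
apply: (@le_trans _ _ ((ln C / ln 2 + (a * (i.+1 ^ 3)%:R + D%:R * (i.+1 ^ 2)%:R)) * ln 2)).
  by rewrite [leRHS]mulrDl divfK ?gt_eqF // -natrM.
apply: (le_trans HIi); rewrite -mulrA ler_wpM2l ?addr_ge0 ?(ltW e0) //.
rewrite mulrBl divfK ?gt_eqF //; exact: dB.
Unshelve. all: by end_near. Qed.

(** A limit superior is bounded below by its values along one sequence of radii. *)
Lemma upper_minkowski_dim_ge E (a : R) (D : nat) : 0 <= a ->
  (forall j, ((2 `^ (a * (level j)%:R - D%:R))%:E <=
     covering_number (2^-1 ^+ (level j).+1) E)%E) ->
  (a%:E <= upper_minkowski_dim E)%E.
Proof.
move=> a0 HE.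
have l2 : 0 < ln (2 : R) by rewrite ln_gt0 // ltr1n.
apply/lee_subgt0Pr => e e0.
apply: le_ereal_inf_tmp => _ [V V0 <-].
have [del /= del0 Vdel] := V0.
have [j0 Hj0] := exists_side_lt del0.
have [j1 Hj1] : exists j1 : nat, (a + D%:R) / e <= j1%:R.
  by exists (Num.truncn ((a + D%:R) / e)).+1; apply/ltW/truncnS_gt.
pose j := maxn j0 j1; pose d : R := 2^-1 ^+ (level j).+1.
have d0 : 0 < d by rewrite exprn_gt0.
have Vd : V d.
  apply: Vdel => //=; rewrite sub0r normrN gtr0_norm //.
  apply: le_lt_trans Hj0; apply: (@le_trans _ _ (2^-1 ^+ level j)).
    by rewrite /d exprS ler_piMl ?exprn_ge0 // invf_le1 // ler1n.
  exact/le_side/leq_maxl.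
apply: le_trans (ereal_sup_ubound _); last by exists d.
have lnd : - ln d = (level j).+1%:R * ln 2.
  by rewrite /d lnXn // lnV ?posrE // mulNrn opprK mulr_natl.
have lnd0 : 0 < - ln d by rewrite lnd mulr_gt0 // ltr0n.
have := HE j; rewrite -/d; case: (covering_number d E) => [N|_|] //; last first.
  by rewrite /= mulyr gtr0_sg ?invr_gt0 // mul1e leey.
rewrite lee_fin => HN.
have N0 : 0 < N by apply: lt_le_trans HN; rewrite powR_gt0.
rewrite lne_EFin // -EFinM -EFinB lee_fin ler_pdivlMr //.
apply: le_trans (_ : (a * (level j)%:R - D%:R) * ln 2 <= _); last first.
  by rewrite -ln_powR ler_ln // ?posrE ?powR_gt0.
rewrite lnd mulrA ler_wpM2r ?(ltW l2) // -natr1.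
have jl : (a + D%:R) <= e * (level j)%:R.
  rewrite mulrC -ler_pdivrMr //; apply: le_trans Hj1 _; rewrite ler_nat.
  by apply: leq_trans (level_ge _); exact: leq_maxr.
lra.
Qed.

End MinkowskiDimension.

(** * The limit set of a sequence of finite sets *)

Section LimitSet.
Context {R : realType} {n : nat}.
Implicit Types (e p x y : 'rV[R]_n) (Q : nat -> seq 'rV[R]_n).

Definition limit_set Q : set 'rV[R]_n :=
  [set e | forall j, exists2 p, p \in Q j & close_to j e p].

(** A closed box is a product of segments. *)
Lemma close_to_compact j p : compact [set e | close_to j e p].
Proof.
have -> : [set e | close_to j e p] = [set e | forall i,
    `[p 0 i - 2 * 2^-1 ^+ level j, p 0 i + 2 * 2^-1 ^+ level j]%classic (e 0 i)].
  apply/seteqP; split=> e He i; have := He i; rewrite /= in_itv /= ler_norml => /andP[];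
    move=> *; apply/andP; split; lra.
apply: (@rV_compact _ _ (fun i =>
  `[p 0 i - 2 * 2^-1 ^+ level j, p 0 i + 2 * 2^-1 ^+ level j]%classic)) => i.
exact: segment_compact.
Qed.

Lemma close_to_list j (l : seq 'rV[R]_n) :
  [set e | exists2 p, p \in l & close_to j e p] =
  \big[setU/set0]_(p <- l) [set e | close_to j e p].
Proof. by rewrite -bigcup_seq; apply/seteqP; split=> e [p pl He]; exists p. Qed.

Lemma limit_set_compact Q : compact (limit_set Q).
Proof.
have cQ j : compact [set e | exists2 p, p \in Q j & close_to j e p].
  rewrite close_to_list; apply: bigsetU_compact => p _; exact: close_to_compact.
apply: (@subclosed_compact _ _ [set e | exists2 p, p \in Q 0%N & close_to 0 e p]) => //.
  have -> : limit_set Q = \bigcap_j [set e | exists2 p, p \in Q j & close_to j e p].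
    by apply/seteqP; split=> [e He j _|e He j]; exact: He.
  by apply: closed_bigI => j _; apply: compact_closed => //; exact: norm_hausdorff.
by move=> e; exact.
Qed.

Lemma enorm_le (z : 'rV[R]_n) (r : R) : 0 <= r -> (forall i, `|z 0 i| <= r) ->
  enorm z <= n%:R * r.
Proof.
move=> r0 zr; have nr0 : 0 <= n%:R * r by rewrite mulr_ge0.
rewrite /enorm -[leRHS]ger0_norm // -sqrtr_sqr ler_wsqrtr //.
apply: (@le_trans _ _ (\sum_(i < n) r ^+ 2)).
  by apply: ler_sum => i _; rewrite -(real_normK (num_real (z 0 i))) ler_sqr ?nnegrE.
rewrite sumr_const card_ord -[leLHS]mulr_natl exprMn ler_wpM2r ?sqr_ge0 //.
by rewrite -natrX ler_nat; case: (n) => // k; rewrite -{1}(expn1 k.+1) leq_pexp2l.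
Qed.

Lemma enorm_ge (z : 'rV[R]_n) i : `|z 0 i| <= enorm z.
Proof.
rewrite /enorm -sqrtr_sqr ler_wsqrtr // (bigD1 i) //= lerDl.
by apply: sumr_ge0 => k _; exact: sqr_ge0.
Qed.

Lemma diam_le (U : set 'rV[R]_n) (r : R) : 0 <= r ->
  (forall x y, U x -> U y -> enorm (x - y) <= r) -> (diam U <= r%:E)%E.
Proof.
move=> r0 HU; rewrite /diam ge_max lee_fin r0 /=.
by apply: ub_ereal_sup => _ [x Ux [y Uy <-]]; rewrite lee_fin; exact: HU.
Qed.

Lemma diam_ge (U : set 'rV[R]_n) x y : U x -> U y -> ((enorm (x - y))%:E <= diam U)%E.
Proof.
move=> Ux Uy; rewrite /diam le_max; apply/orP; right.
by apply: ereal_sup_ubound; exists x => //; exists y.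
Qed.

Lemma covering_limit_set Q j :
  (covering_number (n%:R * 4 * 2^-1 ^+ level j) (limit_set Q) <= (size (Q j))%:R%:E)%E.
Proof.
apply: ereal_inf_lbound; exists (size (Q j)) => //.
exists (fun i => [set e | close_to j e (nth 0 (Q j) i)]); split.
  move=> e /(_ j)[p pQ ep]; rewrite -index_mem in pQ.
  by exists (Ordinal pQ) => //=; rewrite nth_index // -index_mem.
move=> i; apply: diam_le => [|x y xp yp]; first by rewrite !mulr_ge0 // exprn_ge0.
rewrite -mulrA; apply: enorm_le => [|k]; first by rewrite mulr_ge0 // exprn_ge0.
rewrite !mxE; have := xp k; have := yp k; rewrite !ler_norml.
by move=> /andP[? ?] /andP[? ?]; apply/andP; split; lra.
Qed.

(** A set of diameter at most [d] contains at most one of the points [g i]. *)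
Lemma separated_covering (E : set 'rV[R]_n) (I : finType) (g : I -> 'rV[R]_n) d :
  (forall i, E (g i)) -> (forall i k, i != k -> d < enorm (g i - g k)) ->
  (#|I|%:R%:E <= covering_number d E)%E.
Proof.
move=> Eg sep; apply: le_ereal_inf_tmp => _ [k [U [EU dU]] <-].
rewrite lee_fin ler_nat.
have /choice[h Hh] i : exists h, U h (g i) by have [h _ ?] := EU _ (Eg i); exists h.
have inj : injective h.
  move=> i i' hh; apply/eqP; apply: contraT => /sep.
  have Hi' : U (h i) (g i') by rewrite hh.
  have := le_trans (diam_ge (Hh i) Hi') (dU (h i)).
  by rewrite lee_fin leNgt => /negbTE ->.
by rewrite -[k]card_ord; apply: leq_card inj.
Qed.

End LimitSet.

(** * Padding with grids *)

Section Padding.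
Context {R : realType} {n : nat}.
Variable a : R.
Hypotheses (n_gt0 : (0 < n)%N) (a_ge0 : 0 <= a) (a_le : a <= n%:R).
Implicit Types (e p x y : 'rV[R]_n) (P : nat -> seq 'rV[R]_n).

(** The grid of step [2^-1 ^+ level j] in a cube of side
    [2 ^ (grid_exponent j - level j)] has about [2 ^ (a * level j)] points: enough
    to force dimension [a], and few enough not to exceed it. *)
Definition grid_exponent j := Num.truncn (a / n%:R * (level j)%:R).

Definition corner j (u : digits n (grid_exponent j)) : 'rV[R]_n :=
  \row_i ((u i)%:R / 2 ^+ level j).

Definition grid j := [seq corner u | u <- enum {: digits n (grid_exponent j)}].

Definition padded P j := P j ++ flatten [seq grid i | i <- iota 0 j.+1].

Let nR_gt0 : 0 < n%:R :> R. Proof. by rewrite ltr0n. Qed.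

Lemma grid_exponent_le j : n%:R * (grid_exponent j)%:R <= a * (level j)%:R.
Proof.
rewrite mulrC -ler_pdivlMr // mulrAC truncn_le //.
by rewrite mulr_ge0 // divr_ge0.
Qed.

Lemma grid_exponent_gt j : a * (level j)%:R - n%:R <= n%:R * (grid_exponent j)%:R.
Proof.
have := truncnS_gt (a / n%:R * (level j)%:R); rewrite -/(grid_exponent j).
rewrite mulrAC ltr_pdivrMr // -natr1; lra.
Qed.

(** The cubes filled by the grids shrink as the level grows. *)
Lemma grid_exponent_mono i j : (i <= j)%N ->
  (grid_exponent j <= grid_exponent i + (level j - level i))%N.
Proof.
move=> ij; have lij : (level i <= level j)%N by rewrite /level leq_exp2r.
rewrite -ltnS truncn_lt_nat //; last by rewrite mulr_ge0 // divr_ge0.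
have := truncnS_gt (a / n%:R * (level i)%:R); rewrite -/(grid_exponent i).
rewrite -addSn natrD natrB // => lt.
have b1 : a / n%:R <= 1 by rewrite ler_pdivrMr // mul1r.
have : (a / n%:R) * ((level j)%:R - (level i)%:R) <= (level j)%:R - (level i)%:R.
  by rewrite ler_piMl // subr_ge0 ler_nat.
lra.
Qed.

(** A corner of the grid of level [level j] belongs to all later padded lists, and
    rounding its coordinates down gives a nearby corner of each earlier grid. *)
Lemma grid_sub_limit_set P j (u : digits n (grid_exponent j)) :
  limit_set (padded P) (corner u).
Proof.
have padE i k (w : digits n (grid_exponent k)) : (k <= i)%N -> corner w \in padded P i.
  move=> ki; rewrite mem_cat; apply/orP; right; apply/flattenP.
  exists (grid k); first by apply/mapP; exists k; rewrite // mem_iota add0n ltnS.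
  by apply: map_f; rewrite mem_enum.
move=> i; have [ji|ij] := leqP j i.
  exists (corner u); first exact: padE.
  by move=> k; rewrite subrr normr0 mulr_ge0 // exprn_ge0.
have lij : (level i <= level j)%N by rewrite /level leq_exp2r // ltnW.
pose D := (level j - level i)%N.
have lt k : (u k %/ 2 ^ D < 2 ^ grid_exponent i)%N.
  rewrite ltn_divLR ?expn_gt0 // -expnD; apply: leq_trans (ltn_ord _) _.
  by rewrite leq_exp2l // grid_exponent_mono // ltnW.
exists (corner [ffun k => Ordinal (lt k)]); first exact: padE.
move=> k; rewrite !mxE ffunE /=.
set m := (u k : nat).
have -> : 2 ^+ level j = 2 ^+ level i * 2 ^+ D :> R by rewrite -exprD subnKC.
have {1}-> : m%:R = (m %/ 2 ^ D)%:R * 2 ^+ D + (m %% 2 ^ D)%:R :> R.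
  by rewrite -natrX -natrM -natrD -divn_eq.
have D0 : 0 < 2 ^+ D :> R by rewrite exprn_gt0.
have l0 : 0 < 2 ^+ level i :> R by rewrite exprn_gt0.
have -> : ((m %/ 2 ^ D)%:R * 2 ^+ D + (m %% 2 ^ D)%:R) / (2 ^+ level i * 2 ^+ D) -
   (m %/ 2 ^ D)%:R / 2 ^+ level i = (m %% 2 ^ D)%:R / 2 ^+ D / 2 ^+ level i :> R.
  by field; rewrite !gt_eqF.
rewrite ger0_norm ?divr_ge0 ?(ltW D0) ?(ltW l0) // exprVn ler_wpM2r ?invr_ge0 ?(ltW l0) //.
rewrite ler_pdivrMr // (@le_trans _ _ (2 ^+ D)) // ?ler_peMl ?ler1n ?(ltW D0) //.
by rewrite -natrX ler_nat ltnW // ltn_mod expn_gt0.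
Qed.

Lemma covering_padded_ge P j :
  ((2 `^ (a * (level j)%:R - n%:R))%:E <=
   covering_number (2^-1 ^+ (level j).+1) (limit_set (padded P)))%E.
Proof.
apply: le_trans (separated_covering (@grid_sub_limit_set P j) _).
  rewrite lee_fin card_digits natrX -powR_mulrn // ler_powR ?ler1n //.
  by rewrite natrM; exact: grid_exponent_gt.
move=> u w uw; have [i uwi] : exists i, u i != w i.
  apply/existsP; apply: contraR uw; rewrite negb_exists => /forallP H.
  by apply/eqP/ffunP => i; apply/eqP; rewrite -[_ == _]negbK.
apply: lt_le_trans (enorm_ge _ i); rewrite !mxE -mulrBl normrM.
rewrite [X in _ < _ * X]ger0_norm ?invr_ge0 ?exprn_ge0 //.
apply: (@lt_le_trans _ _ (2^-1 ^+ level j)).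
  by rewrite exprS gtr_pMl ?exprn_gt0 // invf_lt1 // ltr1n.
rewrite exprVn ler_peMl ?invr_ge0 ?exprn_ge0 //.
have {}uwi : nat_of_ord (u i) != nat_of_ord (w i) by [].
have -> : (u i)%:R - (w i)%:R = ((u i)%:Z - (w i)%:Z)%:~R :> R by rewrite rmorphB.
have : 1 <= `|(u i)%:Z - (w i)%:Z| :> int.
  by move: uwi; move: (nat_of_ord (u i)) (nat_of_ord (w i)) => k l; lia.
by rewrite -(ler_int R) intr_norm.
Qed.

Lemma size_padded P j (C : R) (D : nat) : 0 <= C ->
  (size (P j))%:R <= C * 2 `^ (a * (level j)%:R + (D * j ^ 2)%:R) ->
  (size (padded P j))%:R <= (C + 1) * 2 `^ (a * (level j)%:R + (D.+1 * j ^ 2)%:R).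
Proof.
move=> C0 HP; rewrite size_cat natrD mulrDl mul1r; apply: lerD.
  apply: le_trans HP _; rewrite ler_wpM2l // ler_powR ?ler1n // lerD2l ler_nat.
  by rewrite leq_mul2r leqnSn orbT.
have sg i : (i <= j)%N -> (size (grid i))%:R <= 2 `^ (a * (level j)%:R) :> R.
  move=> ij; rewrite size_map -cardE card_digits natrX -powR_mulrn //.
  rewrite ler_powR ?ler1n // natrM; apply: le_trans (grid_exponent_le i) _.
  by rewrite ler_wpM2l // ler_nat /level leq_exp2r.
apply: (@le_trans _ _ (\sum_(i <- iota 0 j.+1) 2 `^ (a * (level j)%:R))).
  rewrite size_flatten /shape -map_comp sumnE big_map natr_sum big_seq [leRHS]big_seq.
  by apply: ler_sum => i; rewrite mem_iota add0n ltnS => ij; exact: sg.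
rewrite big_const_seq count_predT size_iota iter_addr_0 -[leLHS]mulr_natr.
rewrite powRD; last by rewrite pnatr_eq0 implybT.
rewrite ler_wpM2l ?powR_ge0 // powR_mulrn // -natrX ler_nat.
apply: leq_trans (ltn_expl j (isT : 1 < 2)%N) _; rewrite leq_exp2l //; nia.
Qed.

End Padding.

(** * From masses on cubes to sumsets *)

Section HittingSet.
Context {R : realType} {n : nat}.
Variables (v0 : 'rV[int]_n) (s c : R) (mu : nat -> 'rV[int]_n -> R).
Hypothesis n_gt0 : (0 < n)%N.
Hypothesis s_ge0 : 0 <= s.
Hypothesis c_gt0 : 0 < c.
Hypothesis mu_root : c <= mu 0%N v0.
Hypothesis mu_le : forall m v, mu m v <= 2 `^ (- (s * m%:R)).
Hypothesis mu_sub : forall m T v,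
  mu m v <= \sum_(u : digits n T) mu (m + T)%N (child v u).

(** Subdividing the root gives [c <= 2 ^ (n * T) * 2 ^ (- s * T)] for all [T], and the
    right-hand side would tend to zero if [s] were larger than [n]. *)
Lemma mass_exponent_le : s <= n%:R.
Proof.
rewrite leNgt; apply/negP => sn; pose b : R := 2 `^ (n%:R - s).
have b0 : 0 < b by rewrite powR_gt0.
have b1 : b < 1.
  by rewrite -ltr_ln ?posrE // ln_powR ln1 pmulr_llt0 ?ln_gt0 ?ltr1n // subr_lt0.
have cb T : c <= b ^+ T.
  apply: le_trans mu_root _; apply: le_trans (mu_sub _ T _) _.
  apply: (@le_trans _ _ (\sum_(u : digits n T) 2 `^ (- (s * T%:R)))).
    by apply: ler_sum => u _; exact: mu_le.
  rewrite sumr_const card_digits -[leLHS]mulr_natl natrX -powR_mulrn //.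
  rewrite -powRD; last by rewrite pnatr_eq0 implybT.
  by rewrite -[leRHS]powR_mulrn ?(ltW b0) // /b -powRrM ler_powR ?ler1n // natrM mulrBl.
have bT : b ^+ T @[T --> \oo] --> (0 : R).
  by apply: cvg_expr; rewrite gtr0_norm.
have : c <= 0.
  rewrite -(cvg_lim _ bT) //; apply: limr_ge; first by apply/cvg_ex; exists 0.
  exact: nearW.
by rewrite leNgt c_gt0.
Qed.

(** The limit set of the tower, padded to have dimension exactly [n - s]. *)
Theorem hitting_set : exists E : set 'rV[R]_n,
  [/\ compact E, upper_minkowski_dim E = (n%:R - s)%:E &
      forall x, cube (0%N, v0) x -> exists2 e, E e & forall j, exists2 p,
        close_to j e p & exists2 v, 0 < mu (level j) v & cube (level j, v) (x - p)].
Proof.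
have sn := mass_exponent_le.
have a0 : 0 <= n%:R - s by rewrite subr_ge0.
have an : n%:R - s <= n%:R by rewrite gerBl.
have [P [sP HP]] := hitting_tower c_gt0 mu_root mu_le mu_sub.
have ci : 0 < c^-1 by rewrite invr_gt0.
exists (limit_set (padded (n%:R - s) P)); split.
- exact: limit_set_compact.
- apply/eqP; rewrite eq_le; apply/andP; split; last first.
    by apply: upper_minkowski_dim_ge => // j; exact: covering_padded_ge.
  apply: (@upper_minkowski_dim_le _ _ _ _ (c^-1 + 1) (n%:R * 4) (loss_rate n).+1) => //.
  + have lt : (0 < 2 ^ @grid_exponent R n (n%:R - s)%R 0)%N by rewrite expn_gt0.
    exists (@corner R n (n%:R - s) 0 [ffun => Ordinal lt]).
    exact: grid_sub_limit_set.
  + by rewrite addr_gt0.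
  + by rewrite mulr_gt0 ?ltr0n.
  + move=> j; apply: le_trans (covering_limit_set _ _) _; rewrite lee_fin.
    by apply: size_padded => //; rewrite ltW.
- move=> x /HP[e He]; exists e => j; have [p pP [ep xp]] := He j; last by exists p.
  by exists p => //; rewrite mem_cat pP.
Qed.

End HittingSet.

Section NetSumset.
Context {R : realType} {n : nat}.
Implicit Types (x y : 'rV[R]_n) (A : set 'rV[R]_n).

Lemma cube_diameter m v x y i : cube (m, v) x -> cube (m, v) y ->
  `|x 0 i - y 0 i| <= 2^-1 ^+ m :> R.
Proof.
rewrite /cube /= => <- /rowP/(_ i); rewrite !mxE => E.
have m0 : 0 < 2 ^+ m :> R by rewrite exprn_gt0.
have := floor_itv (2 ^+ m * y 0 i); rewrite E.
have := floor_itv (2 ^+ m * x 0 i).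
move=> /andP[h1 h2] /andP[h3 h4].
rewrite exprVn -[leRHS]mul1r ler_pdivlMr // -[X in _ * X]gtr0_norm // -normrM.
rewrite intrD in h2 h4.
by rewrite ler_norml mulrBl ![_ * 2 ^+ m]mulrC; apply/andP; split; lra.
Qed.

(** The mass of a cube is the limit of the contents of its intersections with the
    sets [K k].  If cubes of positive mass converge to a point, that point is in
    the closure of all the [K k], hence in [A]. *)
Theorem net_content_sumset (s c : R) (v0 : 'rV[int]_n) A (K : nat -> set 'rV[R]_n) :
  (0 < n)%N -> 0 <= s -> 0 < c ->
  (forall k, K k.+1 `<=` K k) ->
  (forall k, (c%:E <= net_content s (K k `&` cube (0%N, v0)))%E) ->
  \bigcap_k closure (K k) `<=` A ->
  exists E : set 'rV[R]_n, [/\ compact E, upper_minkowski_dim E = (n%:R - s)%:E &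
    cube (0%N, v0) `<=` minkowski_sum A E].
Proof.
move=> n0 s0 c0 decK cK KA.
have decK' k l : (k <= l)%N -> K l `<=` K k.
  move=> /subnKC <-; elim: (l - k)%N => [|d IH]; first by rewrite addn0.
  by rewrite addnS; apply: subset_trans IH.
pose nu k m v : R := fine (net_content s (K k `&` @cube R n (m, v))).
have net_le k m v : (net_content s (K k `&` @cube R n (m, v)) <=
    (2 `^ (- (s * m%:R)))%:E)%E.
  by apply: le_trans (net_content_cube s (m, v)); apply: le_net_content => x [].
have nuE k m v : (nu k m v)%:E = net_content s (K k `&` cube (m, v)).
  rewrite fineK // ge0_fin_numE ?net_content_ge0 //.
  exact: le_lt_trans (net_le _ _ _) (ltry _).
have nu0 k m v : 0 <= nu k m v by rewrite -lee_fin nuE net_content_ge0.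
have nu_dec m v : nonincreasing_seq (fun k => nu k m v).
  move=> k l kl; rewrite -lee_fin !nuE; apply: le_net_content => x [Kx ?].
  by split=> //; exact: decK' Kx.
pose mu m v := inf (range (fun k => nu k m v)).
have nu_cvg m v : nu k m v @[k --> \oo] --> mu m v.
  apply: nonincreasing_cvgn; [exact: nu_dec | by exists 0 => _ [k _ <-]].
have mu_nu k m v : mu m v <= nu k m v.
  by apply: ge_inf; [exists 0 => _ [l _ <-] | exists k].
have [|m v|m T v|E [cE dE hE]] := @hitting_set R n v0 s c mu n0 s0 c0.
- apply: lb_le_inf; first by exists (nu 0%N 0%N v0); exists 0%N.
  by move=> _ [k _ <-]; rewrite -lee_fin nuE.
- by rewrite (le_trans (mu_nu 0%N m v)) // -lee_fin nuE.
- have cvgS : (\sum_(u : digits n T) nu k (m + T)%N (child v u)) @[k --> \oo] -->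
     \sum_(u : digits n T) mu (m + T)%N (child v u).
    by apply: cvg_big => [|u _]; [exact: add_continuous | exact: nu_cvg].
  rewrite -(cvg_lim _ cvgS) //; apply: limr_ge; first by apply/cvg_ex; eexists; exact: cvgS.
  apply: nearW => k; apply: le_trans (mu_nu k m v) _.
  rewrite -lee_fin nuE -sumEFin.
  under eq_bigr => u _ do rewrite nuE.
  apply: net_content_bigsetU => x [Kx mx].
  by have [u Hu] := address_child T mx; exists u.
exists E; split => // x x0; have [e Ee He] := hE x x0.
exists (x - e); last by exists e; rewrite ?subrK.
apply: KA => k _ B /nbhs_ballP[r /= r0 rB].
have [j jr] := exists_side_lt (divr_gt0 r0 (ltr0Sn R 2)).
have [p ep [v mu0 xpv]] := He j.
have [y [Ky yv]] : exists y, (K k `&` cube (level j, v)) y.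
  apply/set0P/eqP => K0.
  by have := lt_le_trans mu0 (mu_nu k _ _); rewrite -lte_fin nuE K0 net_content0 ltxx.
exists y; split => //; apply: rB; split => // i l; rewrite (ord1 i) /ball /=.
have h1 := cube_diameter l xpv yv; have := ep l.
rewrite !mxE in h1 *.
rewrite ltr_pdivlMr // in jr.
move: h1; rewrite !ler_norml ltr_norml => /andP[? ?] /andP[? ?].
by apply/andP; split; lra.
Qed.

End NetSumset.

(** * Hausdorff measures and net contents *)

Section BorelCase.
Context {R : realType} {n : nat}.
Implicit Types (A : set 'rV[R]_n) (s t : R) (C : set (nat * 'rV[int]_n)).
Local Open Scope ereal_scope.

Lemma net_content_exponent s t A : (s <= t)%R -> net_content t A <= net_content s A.
Proof.
move=> st; apply: le_ereal_inf_tmp => _ [C AC <-].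
apply: le_trans (net_content_le_cost _ AC) _; apply: le_esum => c _.
by rewrite lee_fin ler_powR ?ler1n // lerN2 ler_wpM2r.
Qed.

Lemma net_content_unit_cube s A : 0 < net_content s A ->
  exists v, 0 < net_content s (A `&` cube (0%N, v)).
Proof.
move=> A0; apply: contrapT => /forallNP noV.
have z v : net_content s (A `&` cube (0%N, v)) = 0.
  apply/eqP; rewrite eq_le net_content_ge0 andbT leNgt; exact/negP.
have := A0; rewrite ltNge => /negP; apply.
pose B k := if pickle_inv k is Some v then A `&` @cube R n (0%N, v) else set0.
apply: (@le_trans _ _ (net_content s (\bigcup_k B k))).
  apply: le_net_content => x Ax; exists (pickle (address 0 x)) => //.
  by rewrite /B pickleK_inv.
apply: le_trans (net_content_bigcup _ _) _.
rewrite eseries0 // => k _ _; rewrite /B.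
by case: (pickle_inv k) => [v|]; [exact: z | exact: net_content0].
Qed.

(** Converts covers by sets of indices into covers by sequences. *)
Lemma nneseries_pickle_inv (I : countType) (D : set I) (f : I -> \bar R) :
  (forall i, 0 <= f i) ->
  \sum_(0 <= k <oo) (if pickle_inv k is Some i then if i \in D then f i else 0 else 0) =
  \esum_(i in D) f i.
Proof.
move=> f0.
pose g (k : nat) : \bar R :=
  if @pickle_inv I k is Some i then if i \in D then f i else 0 else 0.
change (\sum_(0 <= k <oo) g k = \esum_(i in D) f i).
have g0 k : 0 <= g k by rewrite /g; case: (pickle_inv k) => // i; case: ifP.
rewrite nneseries_esumT //.
have -> : \esum_(i in D) f i = \esum_(i in D) g (pickle i).
  by apply: eq_esum => i Di; rewrite /g pickleK_inv mem_set.
have inj : set_inj D (@pickle I) by move=> i j _ _ ij; exact: (pcan_inj (@pickleK I) ij).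
rewrite -(esum_image _ _ g inj) esum_mkcond [RHS]esum_mkcond.
apply: eq_esum => k _; rewrite in_setT; case: ifPn => // kD.
rewrite /g; case E : (pickle_inv k) => [i|//]; case: ifPn => // iD.
exfalso; move/negP: kD; apply; apply/mem_set; exists i; first exact: set_mem.
by have := @pickle_invK I k; rewrite E.
Qed.

Lemma diam_cube (c : nat * 'rV[int]_n) :
  diam (@cube R n c) <= (n%:R * 2^-1 ^+ c.1)%:E.
Proof.
apply: diam_le => [|x y xc yc]; first by rewrite mulr_ge0 ?exprn_ge0.
apply: enorm_le => [|i]; first by rewrite exprn_ge0.
by case: c xc yc => m v xc yc; rewrite !mxE; exact: cube_diameter yc.
Qed.

(** A cover of small cost consists of small cubes, because the weight of a single
    cube is at most the cost; as [t] is positive, small weight means small diameter. *)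
Lemma hausdorff_measure_net0 t A : (0 < n)%N -> (0 < t)%R ->
  net_content t A = 0 -> hausdorff_measure t A = 0.
Proof.
move=> n0 t0 A0; apply/eqP; rewrite eq_le; apply/andP; split; last first.
  apply: le_ereal_sup_tmp; exists (hausdorff_content t 1 A); first by exists 1%R => //=.
  apply: le_ereal_inf_tmp => _ [U _ <-]; apply: nneseries_ge0 => k _ _.
  by rewrite /diam_pow; case: ifP => // _; exact: poweR_ge0.
apply: ub_ereal_sup => _ [d /= d0 <-].
apply/lee_addgt0Pr => e e0; rewrite add0e.
have nR : (0 < n%:R :> R)%R by rewrite ltr0n.
have [j Hj] := exists_side_lt (divr_gt0 d0 nR); set M := level j in Hj.
have nt : (0 < n%:R `^ t :> R)%R by rewrite powR_gt0.
(* A cost below the first bound forces the level of each cube above [M]; the second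
   bound makes the sum of the diameters' powers at most [e]. *)
pose eta : R := Num.min (2 `^ (- (t * M%:R)))%R (e / (n%:R `^ t))%R.
have eta0 : (0 < eta)%R by rewrite lt_min powR_gt0 // divr_gt0.
have : net_content t A < eta%:E by rewrite A0 lte_fin.
move=> /ereal_inf_lt[_ [C AC <-] Ceta].
have big c : C c -> (M < c.1)%N.
  move=> Cc; rewrite ltnNge; apply/negP => cM.
  have : cube_weight t c <= net_cost t C.
    rewrite -(@esum_set1 _ _ c (cube_weight t)) ?cube_weight_ge0 //.
    by apply: le_esum_subset => _ ->.
  move=> /le_lt_trans/(_ Ceta); rewrite lte_fin ltNge => /negP; apply.
  rewrite ge_min; apply/orP; left; rewrite ler_powR ?ler1n // lerN2.
  by rewrite ler_wpM2l ?(ltW t0) // ler_nat.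
pose U k := if pickle_inv k is Some c then if c \in C then @cube R n c else set0 else set0.
apply: le_trans (_ : \sum_(0 <= k <oo) diam_pow t (U k) <= _).
  apply: ereal_inf_lbound; exists U => //; split.
    move=> x /AC[c Cc cx]; exists (pickle c) => //.
    by rewrite /U pickleK_inv mem_set.
  have d0E : diam (set0 : set 'rV[R]_n) <= d%:E by apply: diam_le => //; exact: ltW.
  move=> k; rewrite /U; case: (pickle_inv k) => // c; case: ifPn => // /set_mem/big cM.
  apply: le_trans (diam_cube c) _; rewrite lee_fin mulrC -ler_pdivlMr //.
  apply: le_trans (ltW Hj); rewrite ler_wiXn2l ?invf_le1 ?ler1n //; exact: ltnW.
apply: le_trans (_ : \sum_(0 <= k <oo) (n%:R `^ t)%:E *
   (if pickle_inv k is Some c then if c \in C then cube_weight t c else 0 else 0) <= _).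
  apply: lee_nneseries => [k _ _|k _].
    by rewrite /diam_pow; case: ifP => // _; exact: poweR_ge0.
  have dp0 : diam_pow t (set0 : set 'rV[R]_n) <= (n%:R `^ t)%:E * 0.
    by rewrite mule0 /diam_pow eqxx.
  rewrite /U; case: (pickle_inv k) => // c; case: ifPn => // _.
  rewrite /diam_pow; case: ifP => [_|_].
    by apply: mule_ge0; [rewrite lee_fin ltW | exact: cube_weight_ge0].
  apply: (@le_trans _ _ ((n%:R * 2^-1 ^+ c.1)%:E `^ t)).
    apply: gt0_ler_poweR; rewrite ?(ltW t0) ?in_itv /= ?leey ?andbT //.
    - by rewrite /diam le_max lexx.
    - exact: diam_cube.
  rewrite poweR_EFin lee_fin powRM ?exprn_ge0 // ler_wpM2l ?(ltW nt) //.
  rewrite /cube_weight exprVn -[(2 ^- _)%R]powR_invn // -powRrM.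
  by rewrite mulNr mulrC.
rewrite nneseriesZl; last first.
  by move=> k _; case: (pickle_inv k) => // c; case: ifP => // _; rewrite lee_fin powR_ge0.
rewrite nneseries_pickle_inv; last by move=> c; exact: cube_weight_ge0.
apply: le_trans (lee_wpmul2l _ (ltW Ceta)) _; first by rewrite lee_fin ltW.
by rewrite -EFinM lee_fin mulrC -ler_pdivlMr // ge_min lexx orbT.
Qed.

End BorelCase.

(** * Borel sets *)

Section Borel.
Context {R : realType} {n : nat}.
Implicit Types (A : set 'rV[R]_n) (s t : R).

Lemma interior_cube v A : cube (0%N, v) `<=` A -> interior A !=set0.
Proof.
move=> vA; exists (\row_i ((v 0 i)%:~R + 2^-1) : 'rV[R]_n).
apply/nbhs_ballP; exists 2^-1; first by rewrite /= invr_gt0.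
move=> y [_ Hy]; apply: vA; rewrite /cube /=; apply/rowP => i.
rewrite mxE expr0 mul1r; apply: floor_def; have := Hy 0 i.
rewrite /ball /= mxE ltr_norml intrD => /andP[h1 h2].
by apply/andP; split; lra.
Qed.

(** Pass to an exponent strictly between [s] and the dimension, at which the
    Hausdorff measure is positive and the exponent itself is positive. *)
Lemma net_content_gt0_of_dim s A : (0 < n)%N -> 0 <= s -> (s%:E < hausdorff_dim A)%E ->
  (0 < net_content s A)%E.
Proof.
move=> n0 s0 sA.
have [t st tA] : exists2 t, s < t & (t%:E < hausdorff_dim A)%E.
  case: (hausdorff_dim A) sA => [r|_|//].
    rewrite lte_fin => sr; exists ((s + r) / 2); rewrite ?lte_fin; lra.
  by exists (s + 1); rewrite ?ltrDl ?ltry.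
have t0 : 0 < t by exact: le_lt_trans st.
apply: lt_le_trans (net_content_exponent A (ltW st)).
rewrite lt_def net_content_ge0 andbT; apply/eqP => A0.
move: tA; rewrite ltNge => /negP; apply.
by apply: ereal_inf_lbound; exists t => //; split; [exact: ltW | exact: hausdorff_measure_net0].
Qed.

(** Restricted to a unit cube, the net content is a capacity with values in the
    unit interval, so [suslin_capacity] applies. *)
Theorem borel_sumset s A : (0 < n)%N -> 0 <= s -> borel_set A ->
  (s%:E < hausdorff_dim A)%E ->
  exists E, [/\ compact E, upper_minkowski_dim E = (n%:R - s)%:E &
    interior (minkowski_sum A E) !=set0].
Proof.
move=> n0 s0 bA sA.
have [v v0] := net_content_unit_cube (net_content_gt0_of_dim n0 s0 sA).
pose Phi X := net_content s (X `&` cube (0%N, v)).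
have Phi1 X : (Phi X <= 1)%E.
  apply: le_trans (le_net_content s (@subIsetr _ X _)) _.
  by apply: le_trans (net_content_cube _ _) _; rewrite /cube_weight mulr0 oppr0 powRr0.
have PhiE X : Phi X = (fine (Phi X))%:E.
  by rewrite fineK // ge0_fin_numE ?net_content_ge0 // (le_lt_trans (Phi1 X)) ?ltry.
pose c := fine (Phi A) / 2.
have c0 : 0 < c by rewrite divr_gt0 // -lte_fin -PhiE.
have cA : (c%:E < Phi A)%E.
  by rewrite PhiE lte_fin /c; have : 0 < fine (Phi A) by [rewrite -lte_fin -PhiE]; lra.
have [| |K [decK cK KA]] := suslin_capacity _ _ (borel_suslin (@open_suslin _ _) bA) cA.
- by move=> X Y XY; apply: le_net_content => x [/XY Yx vx].
- move=> X incX cX; apply: contrapT => /forallNP Xc.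
  move: cX; rewrite ltNge => /negP; apply; rewrite /Phi setI_bigcupl.
  apply: net_content_continuous => k; first by move=> x [/incX].
  by rewrite leNgt; exact/negP/Xc.
have cK' k : (c%:E <= net_content s (K k `&` cube (0%N, v)))%E by exact: ltW (cK k).
have [E [cE dE hE]] := net_content_sumset n0 s0 c0 decK cK' KA.
exists E; split => //; exact: interior_cube hE.
Qed.

End Borel.

(** * Lebesgue outer measure and measurable sets *)

Section CoordinateConditions.
Context {R : realType} {n : nat}.
Implicit Type P : 'I_n -> R -> Prop.

Lemma closed_coords P : (forall i, closed [set r | P i r]) ->
  closed [set x : 'rV[R]_n | forall i, P i (x 0 i)].
Proof.
move=> cP; have -> : [set x : 'rV[R]_n | forall i, P i (x 0 i)] =
    \bigcap_i ((fun x : 'rV[R]_n => x 0 i) @^-1` [set r | P i r]).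
  by apply/seteqP; split=> [x Px i _|x Px i]; exact: Px.
apply: closed_bigI => i _; apply: preimage_closed (cP i) => x _.
exact: coord_continuous.
Qed.

Lemma open_coords P : (forall i, open [set r | P i r]) ->
  open [set x : 'rV[R]_n | forall i, P i (x 0 i)].
Proof.
move=> oP; rewrite -closedC.
have -> : ~` [set x : 'rV[R]_n | forall i, P i (x 0 i)] =
    \bigcup_(i in setT) ((fun x : 'rV[R]_n => x 0 i) @^-1` (~` [set r | P i r])).
  by apply/seteqP; split=> [x /existsNP[i Pi]|x [i _ Pi] Px]; [exists i | exact: Pi (Px i)].
apply: closed_bigcup => [|i _]; first exact: finite_finset.
apply: preimage_closed; last by rewrite closedC.
by move=> x _; exact: coord_continuous.
Qed.

End CoordinateConditions.

Section LebesgueOuter.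
Context {R : realType} {n : nat}.
Hypothesis n_gt0 : (0 < n)%N.
Implicit Types (A B X : set 'rV[R]_n) (a b : 'rV[R]_n).
(** The volume depends continuously on the sides. *)
Lemma box_volume_enlarge a b (e : R) : (0 < e)%R -> exists2 h : R, (0 < h)%R &
  (box_volume (a - const_mx h) (b + const_mx h) <= box_volume a b + e)%R.
Proof.
move=> e0.
pose f (h : R) : R := (\prod_(i < n) (Num.max 0 (b 0 i - a 0 i) + 2 * h))%R.
have cf : f h @[h --> (0 : R)^'+] --> (\prod_(i < n) Num.max 0 (b 0 i - a 0 i))%R.
  apply: cvg_big => [|i _]; first exact: mul_continuous.
  rewrite -[X in _ --> X]addr0 -[X in _ --> _ + X](mulr0 2); apply: cvg_at_right_filter.
  apply: cvgD; first exact: cvg_cst.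
  by apply: cvgM; [exact: cvg_cst | exact: cvg_id].
have : \forall h \near (0 : R)^'+, (0 < h)%R /\ (f h <= box_volume a b + e)%R.
  near=> h; split; first by near: h; exact: nbhs_right_gt.
  by near: h; apply: (cvgr_le _ cf); rewrite /box_volume ltrDl.
move=> /filter_ex[h [h0 fh]]; exists h => //; apply: le_trans fh.
apply: ler_prod => i _; rewrite le_max lexx /= ge_max; apply/andP; split.
  by rewrite addr_ge0 ?le_max ?lexx // mulr_ge0 // ltW.
have : (b 0 i - a 0 i <= Num.max 0 (b 0 i - a 0 i))%R by rewrite le_max lexx orbT.
by rewrite !mxE; lra.
Unshelve. all: by end_near. Qed.

Local Open Scope ereal_scope.

Let vol (ab : 'rV[R]_n * 'rV[R]_n) : \bar R := (box_volume ab.1 ab.2)%:E.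

Lemma box_volume_ge0 a b : (0 <= box_volume a b)%R.
Proof. by apply: prodr_ge0 => i _; rewrite le_max lexx. Qed.

Let vol_ge0 ab : 0 <= vol ab. Proof. by rewrite lee_fin box_volume_ge0. Qed.
Hint Resolve vol_ge0 : core.

Lemma box_volume_diag a : box_volume a a = 0%R.
Proof.
rewrite /box_volume (bigD1 (Ordinal n_gt0)) //=.
by rewrite subrr maxxx mul0r.
Qed.

Lemma lebesgue_outer_ge0 A : 0 <= lebesgue_outer A.
Proof.
by apply: le_ereal_inf_tmp => _ [ab _ <-]; apply: nneseries_ge0 => k _ _; exact: vol_ge0.
Qed.

Lemma le_lebesgue_outer A B : A `<=` B -> lebesgue_outer A <= lebesgue_outer B.
Proof.
move=> AB; apply: ereal_inf_le_tmp => _ [ab Bab <-].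
by exists ab => //; exact: subset_trans Bab.
Qed.

Lemma lebesgue_outer_countable_cover (I : countType) (D : set I)
    (ab : I -> 'rV[R]_n * 'rV[R]_n) A :
  A `<=` \bigcup_(i in D) box (ab i).1 (ab i).2 ->
  lebesgue_outer A <= \esum_(i in D) vol (ab i).
Proof.
move=> AD; rewrite -nneseries_pickle_inv //.
pose ab' k := if @pickle_inv I k is Some i then if i \in D then ab i else (0, 0)%R
              else (0, 0)%R.
apply: (@le_trans _ _ (\sum_(0 <= k <oo) vol (ab' k))).
  apply: ereal_inf_lbound; exists ab' => //= x /AD[i Di xi].
  by exists (pickle i) => //; rewrite /ab' pickleK_inv mem_set.
have v0 : vol (0, 0)%R <= 0 by rewrite /vol box_volume_diag.
apply: lee_nneseries => [//|k _]; rewrite /ab'.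
by case: (pickle_inv k) => // i; case: ifP.
Qed.

Lemma lebesgue_outer0 : lebesgue_outer (set0 : set 'rV[R]_n) = 0.
Proof.
apply/eqP; rewrite eq_le lebesgue_outer_ge0 andbT.
have := @lebesgue_outer_countable_cover nat set0 (fun=> (0, 0)%R) set0.
by rewrite esum_set0; apply.
Qed.

Lemma lebesgue_outer_bigcup (B : nat -> set 'rV[R]_n) :
  lebesgue_outer (\bigcup_k B k) <= \sum_(0 <= k <oo) lebesgue_outer (B k).
Proof.
have [[k Bk]|/forallNP Boo] := pselect (exists k, lebesgue_outer (B k) = +oo).
  suff -> : \sum_(0 <= k <oo) lebesgue_outer (B k) = +oo by rewrite leey.
  apply/eqP; rewrite -leye_eq -Bk (@nneseriesD1 _ _ k) //.
    by rewrite leeDl // nneseries_ge0 // => *; exact: lebesgue_outer_ge0.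
  by move=> *; exact: lebesgue_outer_ge0.
apply/lee_addgt0Pr => e e0.
apply: le_trans (epsilon_trick _ _ (ltW e0)); last by move=> *; exact: lebesgue_outer_ge0.
have /choice[ab Hab] k : exists ab : nat -> 'rV[R]_n * 'rV[R]_n,
    B k `<=` \bigcup_l box (ab l).1 (ab l).2 /\
    \sum_(0 <= l <oo) vol (ab l) <= lebesgue_outer (B k) + (e / (2 ^ k.+1)%:R)%:E.
  have fin : lebesgue_outer (B k) \is a fin_num.
    by rewrite ge0_fin_numE ?lebesgue_outer_ge0 // ltey; apply/eqP.
  have ek : (0 < e / (2 ^ k.+1)%:R)%R by rewrite divr_gt0 // ltr0n expn_gt0.
  have [_ [ab Bab <-] /ltW le] := lb_ereal_inf_adherent ek fin.
  by exists ab.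
apply: le_trans (@lebesgue_outer_countable_cover _ [set: nat * nat]
  (fun kl => ab kl.1 kl.2) _ _) _.
  by move=> x [k _ /(Hab k).1[l _ xl]]; exists (k, l).
have -> : [set: nat * nat] = [set: nat] `*`` (fun=> [set: nat]).
  by apply/seteqP; split.
rewrite -(esum_esum (a := fun k l => vol (ab k l))) // -nneseries_esumT; last first.
  by move=> k; apply: esum_ge0.
apply: lee_nneseries => [k _ _|k _]; first exact: esum_ge0.
by rewrite -nneseries_esumT //; exact: (Hab k).2.
Qed.

Lemma lebesgue_outerU A B :
  lebesgue_outer (A `|` B) <= lebesgue_outer A + lebesgue_outer B.
Proof.
apply: le_trans (_ : lebesgue_outer (\bigcup_k (if k == 0%N then A else if k == 1%N then B else set0)) <= _).
  by apply: le_lebesgue_outer => x [Ax|Bx]; [exists 0%N | exists 1%N].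
apply: le_trans (lebesgue_outer_bigcup _) _.
rewrite (nneseries_split 0 2) /=; last by move=> *; exact: lebesgue_outer_ge0.
rewrite !big_nat_recr //= big_nil add0r eseries0 ?adde0 //.
move=> [|[|k]] //= _ _; exact: lebesgue_outer0.
Qed.

Lemma lebesgue_outer_box a b : lebesgue_outer (box a b) <= (box_volume a b)%:E.
Proof.
have := @lebesgue_outer_countable_cover unit setT (fun=> (a, b)) (box a b).
have -> : [set: unit] = [set tt] by apply/seteqP; split=> [[]|].
by rewrite esum_set1 // bigcup_set1; apply.
Qed.

(** A dyadic cube of level [m] has volume [2 ^ (- n * m)], its weight for the
    exponent [n]. *)
Lemma lebesgue_outer_net A : lebesgue_outer A <= net_content n%:R A.
Proof.
apply: le_ereal_inf_tmp => _ [C AC <-].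
pose ab (c : nat * 'rV[int]_n) : 'rV[R]_n * 'rV[R]_n :=
  (grid_point c.1 c.2, grid_point c.1 (c.2 + const_mx 1)%R).
apply: le_trans (@lebesgue_outer_countable_cover _ C ab _ _) _.
  move=> x /AC[c Cc /rowP cx]; exists c => // i.
  have := cx i; rewrite /ab !mxE /= intrD => <-.
  have := floor_itv (2 ^+ c.1 * x 0 i)%R; rewrite intrD => /andP[h1 /ltW h2].
  have m0 : (0 < 2 ^+ c.1 :> R)%R by rewrite exprn_gt0.
  by rewrite ler_pdivrMr // ler_pdivlMr // [(x 0%R i * _)%R]mulrC h1.
apply: le_esum => c _; rewrite lee_fin /box_volume.
have -> : (\prod_(i < n) Num.max 0 ((ab c).2 0 i - (ab c).1 0 i) =
   \prod_(i < n) 2^-1 ^+ c.1)%R.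
  apply: eq_bigr => i _; rewrite !mxE intrD mulrDl addrAC subrr add0r mul1r.
  by rewrite max_r ?invr_ge0 ?exprn_ge0 // exprVn.
by rewrite prodr_const card_ord -exprM exprVn -powR_invn // mulnC natrM.
Qed.

(** Inside a closed unit cube [X] met by [A] in positive measure, cover [X] minus
    [A] by open boxes of total volume only slightly above its outer measure, and
    remove them from [X].  The Caratheodory condition for [A], tested on [X], shows
    that what is left has positive outer measure. *)
Lemma measurable_closed_subset A : lebesgue_measurable A -> 0 < lebesgue_outer A ->
  exists K, [/\ closed K, K `<=` A & 0 < lebesgue_outer K].
Proof.
move=> mA A0.
pose lo (v : 'rV[int]_n) : 'rV[R]_n := grid_point 0 v.
pose X (v : 'rV[int]_n) : set 'rV[R]_n := box (lo v) (lo v + const_mx 1)%R.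
have [v Av] : exists v, 0 < lebesgue_outer (X v `&` A).
  apply: contrapT => /forallNP noV.
  have z v : lebesgue_outer (X v `&` A) = 0.
    apply/eqP; rewrite eq_le lebesgue_outer_ge0 andbT leNgt; exact/negP.
  have := A0; rewrite ltNge => /negP; apply.
  pose B k := if @pickle_inv 'rV[int]_n k is Some v then X v `&` A else set0.
  apply: (@le_trans _ _ (lebesgue_outer (\bigcup_k B k))).
    apply: le_lebesgue_outer => x Ax; exists (pickle (address 0 x)) => //.
    rewrite /B pickleK_inv; split => // i; rewrite !mxE expr0 divr1 mul1r.
    by have := floor_itv (x 0%R i); rewrite intrD => /andP[-> /ltW ->].
  apply: le_trans (lebesgue_outer_bigcup _) _.
  rewrite eseries0 // => k _ _; rewrite /B.
  by case: (pickle_inv k) => [v|]; [exact: z | exact: lebesgue_outer0].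
have Xfin : lebesgue_outer (X v) < +oo.
  exact: le_lt_trans (lebesgue_outer_box _ _) (ltry _).
have fin Y : Y `<=` X v -> lebesgue_outer Y \is a fin_num.
  move=> YX; rewrite ge0_fin_numE ?lebesgue_outer_ge0 //.
  exact: le_lt_trans (le_lebesgue_outer YX) Xfin.
have fA := fin _ (@subIsetl _ (X v) A); have fC := fin _ (@subIsetl _ (X v) (~` A)).
pose al := fine (lebesgue_outer (X v `&` A)).
have al0 : (0 < al)%R by rewrite -lte_fin fineK.
have [_ [ab Xab <-] abe] := lb_ereal_inf_adherent (divr_gt0 al0 (ltr0Sn R 3)) fC.
have /choice[h Hh] k : exists h : R, (0 < h)%R /\
  (box_volume ((ab k).1 - const_mx h) ((ab k).2 + const_mx h) <=
   box_volume (ab k).1 (ab k).2 + al / 4 / (2 ^ k.+1)%:R)%R.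
  have ek : (0 < al / 4 / (2 ^ k.+1)%:R)%R.
    by rewrite !divr_gt0 // ltr0n expn_gt0.
  by have [h h0 hv] := box_volume_enlarge (ab k).1 (ab k).2 ek; exists h.
pose U k := [set x : 'rV[R]_n | forall i,
  ((ab k).1 0 i - h k < x 0 i < (ab k).2 0 i + h k)%R].
have oU k : open (U k).
  apply: (@open_coords R n (fun i r =>
    ((ab k).1 0 i - h k < r < (ab k).2 0 i + h k)%R)) => i.
  rewrite (_ : [set r : R | _] = `](ab k).1 0%R i - h k, (ab k).2 0%R i + h k[%classic)%R.
    exact: itv_open.
  by apply/seteqP; split=> r; rewrite /= in_itv.
pose K := X v `\` \bigcup_k U k.
exists K; split.
- apply: closedI; last by rewrite closedC; apply: bigcup_open => k _; exact: oU.
  apply: (@closed_coords R n (fun i r =>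
    (lo v 0 i <= r <= (lo v + const_mx 1) 0 i)%R)) => i.
  rewrite (_ : [set r : R | _] = `[lo v 0%R i, (lo v + const_mx 1)%R 0%R i]%classic).
    exact: itv_closed.
  by apply/seteqP; split=> r; rewrite /= in_itv.
- move=> x [Xx nUx]; apply: contrapT => nAx; apply: nUx.
  have [k _ kx] := Xab x (conj Xx nAx); exists k => // i.
  by have /andP[? ?] := kx i; have [? _] := Hh k; apply/andP; split; lra.
(* The enlarged closed boxes contain the open ones that were removed. *)
have cov : X v `<=` K `|` \bigcup_k box ((ab k).1 - const_mx (h k))%R ((ab k).2 + const_mx (h k))%R.
  move=> x Xx; have [[k _ Ux]|nUx] := pselect ((\bigcup_k U k) x); last by left.
  by right; exists k => // i; have /andP[/ltW ? /ltW ?] := Ux i; rewrite !mxE; apply/andP.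
have b0 k : 0 <= (box_volume (ab k).1 (ab k).2)%:E by exact: vol_ge0.
have big : lebesgue_outer (X v) <= lebesgue_outer K +
    (lebesgue_outer (X v `&` ~` A) + (al / 4)%:E + (al / 4)%:E).
  apply: le_trans (le_lebesgue_outer cov) _; apply: le_trans (lebesgue_outerU _ _) _.
  rewrite leeD2l //; apply: le_trans (lebesgue_outer_bigcup _) _.
  apply: le_trans (leeD2r _ (ltW abe)).
  apply: le_trans (epsilon_trick _ _ _); last by rewrite divr_ge0 // ltW.
    apply: lee_nneseries => [k _ _|k _]; first exact: lebesgue_outer_ge0.
    apply: le_trans (lebesgue_outer_box _ _) _.
    by rewrite -EFinD lee_fin; exact: (Hh k).2.
  by move=> *; exact: b0.
have fK := fin K (@subIsetl _ (X v) _).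
move: big; rewrite (mA (X v)) -(fineK fA) -(fineK fC) -(fineK fK) -!EFinD !lee_fin lte_fin.
rewrite -/al; lra.
Qed.

(** A closed set of positive outer measure has positive net content for the
    exponent [n]. *)
Theorem measurable_sumset A : lebesgue_measurable A -> 0 < lebesgue_outer A ->
  exists E : set 'rV[R]_n, [/\ compact E, upper_minkowski_dim E = 0%:E &
    interior (minkowski_sum A E) !=set0].
Proof.
move=> mA A0; have [K [cK KA K0]] := measurable_closed_subset mA A0.
have [v v0] := net_content_unit_cube (lt_le_trans K0 (lebesgue_outer_net K)).
set N := net_content _ _ in v0.
have N1 : N <= 1.
  apply: le_trans (le_net_content _ (@subIsetr _ K _)) _.
  by apply: le_trans (net_content_cube _ _) _; rewrite /cube_weight mulr0 oppr0 powRr0.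
have NE : N = (fine N)%:E.
  by rewrite fineK // ge0_fin_numE ?net_content_ge0 // (le_lt_trans N1) ?ltry.
have n0 : (0 <= n%:R :> R)%R by [].
have N0 : (0 < fine N)%R by rewrite -lte_fin -NE.
have [||x|E [cE dE hE]] := @net_content_sumset R n n%:R (fine N) v A (fun=> K) n_gt0 n0 N0.
- by move=> _ x.
- by move=> _; rewrite -NE.
- by move=> /(_ 0%N I); rewrite -(closure_id K).1 //; exact: KA.
by exists E; split => //; [rewrite dE subrr | exact: interior_cube hE].
Qed.

End LebesgueOuter.

(** * Sumsets with nonempty interior *)

Theorem lemma1p6 (R : realType) (n : nat) (n_ge1 : (1 <= n)%N) :
  (forall A : set 'rV[R]_n,
     lebesgue_measurable A ->
     (0 < lebesgue_outer A)%E ->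
     exists E : set 'rV[R]_n,
       [/\ compact E,
           upper_minkowski_dim E = 0%:E &
           interior (minkowski_sum A E) !=set0]) /\
  (forall (s : R) (A : set 'rV[R]_n),
     0 <= s ->
     A !=set0 ->
     borel_set A ->
     (s%:E < hausdorff_dim A)%E ->
     exists E : set 'rV[R]_n,
       [/\ compact E,
           upper_minkowski_dim E = (n%:R - s)%:E &
           interior (minkowski_sum A E) !=set0]).
Proof.
split=> [A mA A0|s A s0 _ bA sA]; first exact: measurable_sumset.
exact: borel_sumset.
Qed.
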